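(* Let $f\in M^!_{k,\chi,\rho}$ and let $n_0\in\mathbb{N}$ be such that $f_j(\tau)=O(e^{2\pi n_0 v})$ as $v=\mathrm{Im}(\tau)\to\infty$ for each $1\le j\le m$. Let $\varphi$ be a non-zero piecewise smooth complex-valued function such that, for some $\epsilon>0$, both $\varphi(x)$ and $\varphi(x^{-1})$ are $o(e^{-2\pi(n_0+\epsilon)x})$ as $x\to\infty$. Then the series $L(s,f,\varphi):=L_f(\varphi_s)$, where $\varphi_s(x):=\varphi(x)x^{s-1}$, converges absolutely for $\mathrm{Re}(s)>\frac12$, has an analytic continuation to all $s\in\mathbb{C}$, and satisfies the functional equation \[L(s,f,\varphi)=i^k\rho(S)\,L(1-s,f,\varphi|_{1-k,\chi^{-1}}S),\] where $(\varphi|_{1-k,\chi^{-1}}S)(x):=x^{k-1}\chi(S)\varphi(1/x)$.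
   Context: Let $\Gamma=\mathrm{SL}_2(\mathbb{Z})$, $S=\left(\begin{smallmatrix}0&-1\\1&0\end{smallmatrix}\right)$. Let $k\in\frac12\mathbb{Z}$, $\chi$ a unitary multiplier system of weight $k$ on $\Gamma$ ($|\chi|=1$ and $\chi(\gamma_1\gamma_2)(c_3\tau+d_3)^k=\chi(\gamma_1)\chi(\gamma_2)(c_1\gamma_2\tau+d_1)^k(c_2\tau+d_2)^k$, where $\gamma_1\gamma_2=\left(\begin{smallmatrix}a_3&b_3\\c_3&d_3\end{smallmatrix}\right)$), $\rho:\Gamma\to\mathrm{GL}(m,\mathbb{C})$ a unitary representation, $\mathbf{e}_1,\dots,\mathbf{e}_m$ the standard basis of $\mathbb{C}^m$, and $(f|_{k,\chi,\rho}\gamma)(\tau):=(c\tau+d)^{-k}\chi(\gamma)^{-1}\rho(\gamma)^{-1}f(\gamma\tau)$. Fix $\kappa_1,\dots,\kappa_m\in[0,1)$. $M^!_{k,\chi,\rho}$ is the space of holomorphic $f=\sum_jf_j\mathbf{e}_j$ on $\mathbb{H}$ with $f|_{k,\chi,\rho}\gamma=f$ for all $\gamma\in\Gamma$ and $f_j(\tau)=\sum_{n+\kappa_j\gg0}a_{f,j}(n)e^{2\pi i(n+\kappa_j)\tau}$. With $\mathcal{L}$ the Laplace transform $(\mathcal{L}\varphi)(s)=\int_0^\infty e^{-st}\varphi(t)dt$, $\mathcal{F}_f$ is the space of $\varphi:\mathbb{R}_+\to\mathbb{C}$ such that $(\mathcal{L}\varphi)(s)$ converges for $\mathrm{Re}(s)\ge-2\pi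 n_0$ and for each $j$ the series $\sum_n|a_{f,j}(n)|(\mathcal{L}|\varphi|)(2\pi(n+\kappa_j))$ converges; for $\varphi\in\mathcal{F}_f$, $L_f(\varphi):=\sum_{j=1}^m\sum_na_{f,j}(n)(\mathcal{L}\varphi)(2\pi(n+\kappa_j))\mathbf{e}_j$. ''Converges absolutely'' for $L(s,f,\varphi)$ means $\varphi_s\in\mathcal{F}_f$. *)

(* Defs.v *)
From HB Require Import structures.
From mathcomp Require Import all_boot all_order all_algebra.
From mathcomp Require Import complex.
From mathcomp Require Import all_classical all_reals all_analysis.

Set Implicit Arguments.
Unset Strict Implicit.
Unset Printing Implicit Defensive.

Import Order.TTheory GRing.Theory Num.Theory.
Import numFieldNormedType.Exports.

Local Open Scope classical_set_scope.
Local Open Scope ring_scope.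
Local Open Scope complex_scope.

Local Notation Re := complex.Re.
Local Notation Im := complex.Im.
Local Notation normc := ComplexField.Normc.normc.

Section ComplexFunctions.
Variable R : realType.
Implicit Types (z w : R[i]) (D : set R[i]).

Definition cexp z : R[i] :=
  (expR (Re z) * cos (Im z)) +i* (expR (Re z) * sin (Im z)).

(* Principal argument, with values in ]-pi, pi]. *)
Definition carg z : R :=
  if 0 <= Im z then acos (Re z / normc z) else - acos (Re z / normc z).

Definition clog z : R[i] := ln (normc z) +i* carg z.

(* Principal branch of z ^ w, meant for z != 0. *)
Definition cpow z w : R[i] := cexp (w * clog z).

(* On the one-dimensional space R[i]^o over R[i], derivability in the
   direction 1 is complex differentiability. *)
Definition holomorphic_on D (g : R[i] -> R[i]) : Prop :=
  forall z, D z -> derivable (g : R[i]^o -> R[i]^o) z 1.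

(* Sum of g n over -N <= n < N. *)
Definition zpartial (g : int -> R[i]) (N : nat) : R[i] :=
  \sum_(i < N) g i%:Z + \sum_(i < N) g (- i.+1%:Z).

Definition has_zsum (g : int -> R[i]) (l : R[i]) : Prop :=
  zpartial g N @[N --> \oo] --> (l : R[i]^o).

Definition zsum (g : int -> R[i]) : R[i] :=
  lim (zpartial g N @[N --> \oo] : set_system R[i]^o).

End ComplexFunctions.

Section ModularForms.
Variable R : realType.
Implicit Types (g : 'M[int]_2) (tau : R[i]).

Definition SL2Z : set 'M[int]_2 := [set g | \det g = 1].

Definition Smx : 'M[int]_2 :=
  \matrix_(i < 2, j < 2) nth 0 (nth [::] [:: [:: 0; -1]; [:: 1; 0]] i) j.

Definition upper_half : set R[i] := [set tau | 0 < Im tau].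

(* The factor c tau + d. *)
Definition autj g tau : R[i] := (g 1 0)%:~R * tau + (g 1 1)%:~R.

Definition moebius g tau : R[i] :=
  ((g 0 0)%:~R * tau + (g 0 1)%:~R) / autj g tau.

Definition half_integer (k : R) : Prop := exists l : int, k = l%:~R / 2.

Definition unitary_multiplier (k : R) (chi : 'M[int]_2 -> R[i]) : Prop :=
  (forall g, SL2Z g -> normc (chi g) = 1) /\
  (forall g1 g2 tau, SL2Z g1 -> SL2Z g2 -> upper_half tau ->
     chi (g1 *m g2) * cpow (autj (g1 *m g2) tau) k%:C =
     chi g1 * chi g2 * cpow (autj g1 (moebius g2 tau)) k%:C
       * cpow (autj g2 tau) k%:C).

Definition unitary_rep m (rho : 'M[int]_2 -> 'M[R[i]]_m) : Prop :=
  (forall g, SL2Z g -> rho g \is unitarymx) /\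
  (forall g1 g2, SL2Z g1 -> SL2Z g2 -> rho (g1 *m g2) = rho g1 *m rho g2).

Definition slash m (k : R) (chi : 'M[int]_2 -> R[i])
    (rho : 'M[int]_2 -> 'M[R[i]]_m) (f : R[i] -> 'cV[R[i]]_m) g tau
    : 'cV[R[i]]_m :=
  (cpow (autj g tau) (- k)%:C * (chi g)^-1)
    *: (invmx (rho g) *m f (moebius g tau)).

(* a j n is the coefficient of e^(2 pi i (n + kappa_j) tau) in f_j. *)
Definition fourier_expansion m (kappa : 'I_m -> R)
    (f : R[i] -> 'cV[R[i]]_m) (a : 'I_m -> int -> R[i]) : Prop :=
  forall j,
    (exists n1 : int, forall n : int, n < n1 -> a j n = 0) /\
    (forall tau, upper_half tau ->
       has_zsum (fun n : int =>
           a j n * cexp (2 * pi%:C * 'i * (n%:~R + (kappa j)%:C) * tau))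
         (f tau j 0)).

Definition weakly_holomorphic_form m (k : R) (chi : 'M[int]_2 -> R[i])
    (rho : 'M[int]_2 -> 'M[R[i]]_m) (kappa : 'I_m -> R)
    (f : R[i] -> 'cV[R[i]]_m) : Prop :=
  [/\ forall j, holomorphic_on upper_half (fun tau => f tau j 0),
      forall g tau, SL2Z g -> upper_half tau -> slash k chi rho f g tau = f tau
    & exists a, fourier_expansion kappa f a].

(* The coefficients a_{f,j}(n), which the expansion of f determines
   uniquely. *)
Definition fcoef m (kappa : 'I_m -> R) (f : R[i] -> 'cV[R[i]]_m)
    : 'I_m -> int -> R[i] :=
  xget (fun _ _ => 0) [set a | fourier_expansion kappa f a].

Definition growth_at_cusp m (n0 : nat) (f : R[i] -> 'cV[R[i]]_m) : Prop :=
  forall j, exists M V : R, forall tau, upper_half tau -> V <= Im tau ->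
    normc (f tau j 0) <= M * expR (2 * pi * n0%:R * Im tau).

End ModularForms.

(* Functions on the positive reals are represented by total functions
   R -> R[i] whose values outside ]0, +oo[ are never used. *)
Section TestFunctions.
Variable R : realType.
Implicit Types (phi : R -> R[i]) (s : R[i]).

(* Smooth on ]a, b[, all derivatives having finite one-sided limits at the
   end points. *)
Definition smooth_on_piece (h : R -> R) (a b : R) : Prop :=
  forall n : nat,
    [/\ forall x, a < x < b -> derivable (derive1n n h) x 1,
        cvg (derive1n n h x @[x --> a^'+])
      & cvg (derive1n n h x @[x --> b^'-])].

(* Finitely many pieces on each compact subinterval of ]0, +oo[; the values at
   the break points are unconstrained. *)
Definition piecewise_smooth phi : Prop :=
  forall a b : R, 0 < a -> a < b ->
    exists2 t : seq R, itv_partition a b t &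
      forall i, (i < size t)%N ->
        smooth_on_piece (fun x => Re (phi x)) (nth a (a :: t) i) (nth a t i) /\
        smooth_on_piece (fun x => Im (phi x)) (nth a (a :: t) i) (nth a t i).

Definition little_o_exp phi (c : R) : Prop :=
  normc (phi x) / expR (- (2 * pi * c * x)) @[x --> +oo] --> (0 : R).

Definition laplace_integrand phi s (t : R) : R[i] := cexp (- s * t%:C) * phi t.

Definition laplace_cvg phi s : Prop :=
  lebesgue_measure.-integrable `]0%R, +oo[
    (fun t : R => (Re (laplace_integrand phi s t))%:E) /\
  lebesgue_measure.-integrable `]0%R, +oo[
    (fun t : R => (Im (laplace_integrand phi s t))%:E).

Definition laplace phi s : R[i] :=
  (\int[lebesgue_measure]_(t in `]0%R, +oo[) Re (laplace_integrand phi s t))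
  +i* (\int[lebesgue_measure]_(t in `]0%R, +oo[)
         Im (laplace_integrand phi s t)).

(* The Laplace transform of |phi| at a real point, possibly +oo. *)
Definition laplace_abs phi (x : R) : \bar R :=
  (\int[lebesgue_measure]_(t in `]0%R, +oo[)
     (expR (- (x * t)) * normc (phi t))%:E)%E.

Definition twist phi s (x : R) : R[i] := phi x * cpow x%:C (s - 1).

(* The function phi|_{1-k, chi^-1} S. *)
Definition slashS (k : R) (chi : 'M[int]_2 -> R[i]) phi (x : R) : R[i] :=
  (x `^ (k - 1))%:C * chi Smx * phi x^-1.

End TestFunctions.

Section LSeries.
Variables (R : realType) (m : nat) (kappa : 'I_m -> R).
Implicit Types (f : R[i] -> 'cV[R[i]]_m) (phi : R -> R[i]) (s : R[i]).

(* The space F_f. *)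
Definition admissible f (n0 : nat) phi : Prop :=
  (forall s, - (2 * pi * n0%:R) <= Re s -> laplace_cvg phi s) /\
  (forall j, (\esum_(n in [set: int])
       ((normc (fcoef kappa f j n))%:E *
        laplace_abs phi (2 * pi * (n%:~R + kappa j))) < +oo)%E).

Definition Lpairing f phi : 'cV[R[i]]_m :=
  \col_j zsum (fun n : int =>
    fcoef kappa f j n * laplace phi (2 * pi * (n%:~R + kappa j))%:C).

Definition Lseries s f phi : 'cV[R[i]]_m := Lpairing f (twist phi s).

Definition Lseries_abs_cvg (n0 : nat) s f phi : Prop :=
  admissible f n0 (twist phi s).

Definition is_entire_continuation (L F : R[i] -> 'cV[R[i]]_m) : Prop :=
  (forall j, holomorphic_on setT (fun s => F s j 0)) /\
  (forall s, 1 / 2 < Re s -> F s = L s).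

End LSeries.

(* Main.v *)
(* For every s the series is a Mellin transform: L(s, f, phi)_j is the integral
   over t > 0 of f_j(i t) phi(t) t^(s-1).  The interchange of sum and integral
   needs a majorant of sum_n |a_j(n)| e^(-2 pi (n + kappa_j) t).  For large t it
   is O(e^(2 pi n0 t)), because the growth condition kills the coefficients with
   n + kappa_j < - n0.  For small t, modularity transports the bound at the cusp:
   every tau with Im tau <= 1 is mapped by some element of SL2(Z) to a point of
   imaginary part between 1/5 and 1 / Im tau, whence f(u + i v) is
   O(e^(2 pi c / v)) for every c > n0; the same bound follows for
   |a_j(n)| e^(-2 pi (n + kappa_j) v) and, after an arbitrarily small change of
   v, for the whole sum.  The decay of phi at 0 and at infinity beats both bounds
   for every s, so the series itself converges everywhere and is entire.  The
   functional equation is the substitution t -> 1 / t combined with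
   f(i / t) = (i t)^k chi(S) rho(S) f(i t). *)

Require Import Defs.
From HB Require Import structures.
From mathcomp Require Import all_boot all_order all_algebra.
From mathcomp Require Import complex.
From mathcomp Require Import all_classical all_reals all_analysis.
From mathcomp Require Import measurable_realfun ring lra.

Set Implicit Arguments.
Unset Strict Implicit.
Unset Printing Implicit Defensive.

Import Order.TTheory GRing.Theory Num.Theory.
Import numFieldNormedType.Exports.

Local Open Scope classical_set_scope.
Local Open Scope ring_scope.
Local Open Scope complex_scope.

Local Notation Re := complex.Re.
Local Notation Im := complex.Im.
Local Notation normc := ComplexField.Normc.normc.

(** * Complex exponential and complex limits *)

Section ComplexBasics.
Variable R : realType.
Implicit Types (z w : R[i]) (x y t : R).

(** What shapes the proof is a chain of small losses in the exponent. Absorbing |c tau + d|^(-k)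
    into the exponential raises n0 to a slightly larger constant, summing the individual coefficient
    bounds raises it again, and each power of t multiplying phi lowers its rate of decay. Hence
    every estimate has a strict inequality between two exponents, and the room epsilon is shared out
    among them. The number 1/5 comes from Dirichlet's theorem, which gives |c u + d| <= v^(1/2) and
    c v <= 2 v^(1/2), so that |c tau + d|^2 <= 5 v. Series and integral are exchanged by dominated
    convergence along partial sums; the measurability of t -> f_j(i t) phi(t) is a by-product, since
    it is a pointwise limit of measurable functions. *)

Lemma normc_sqrtE z : normc z = Num.sqrt (Re z ^+ 2 + Im z ^+ 2).
Proof. by case: z. Qed.

Lemma normc_ge0 z : 0 <= normc z.
Proof. by rewrite normc_sqrtE sqrtr_ge0. Qed.

Lemma sqr_normc_ReIm z : normc z ^+ 2 = Re z ^+ 2 + Im z ^+ 2.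
Proof. by rewrite normc_sqrtE sqr_sqrtr// addr_ge0// sqr_ge0. Qed.

Lemma normr_complexE z : `|z| = (normc z)%:C.
Proof. by rewrite normc_def normc_sqrtE. Qed.

Lemma normc_real x : normc x%:C = `|x|.
Proof. by rewrite normc_sqrtE/= expr0n/= addr0 sqrtr_sqr. Qed.

Lemma normr_Re_le z : `|Re z| <= normc z.
Proof.
rewrite -ler_sqr ?nnegrE ?normc_ge0// sqr_normc_ReIm real_normK ?num_real//.
by rewrite lerDl sqr_ge0.
Qed.

Lemma normr_Im_le z : `|Im z| <= normc z.
Proof.
rewrite -ler_sqr ?nnegrE ?normc_ge0// sqr_normc_ReIm real_normK ?num_real//.
by rewrite lerDr sqr_ge0.
Qed.

Lemma normc_le_ReIm z : normc z <= `|Re z| + `|Im z|.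
Proof.
rewrite -ler_sqr ?nnegrE ?normc_ge0 ?addr_ge0// sqr_normc_ReIm sqrrD.
rewrite !real_normK ?num_real// -addrA [X in _ <= _ + X]addrC addrA lerDl.
by rewrite mulrn_wge0// mulr_ge0.
Qed.

Lemma normc_sum (I : Type) (r : seq I) (P : pred I) (F : I -> R[i]) :
  normc (\sum_(i <- r | P i) F i) <= \sum_(i <- r | P i) normc (F i).
Proof.
elim/big_rec2: _ => [|i y z _ ih]; first by rewrite ComplexField.Normc.normc0.
by rewrite (le_trans (le_normcD _ _))// lerD2l.
Qed.

Lemma cReD z w : Re (z + w) = Re z + Re w. Proof. by case: z; case: w. Qed.
Lemma cImD z w : Im (z + w) = Im z + Im w. Proof. by case: z; case: w. Qed.
Lemma cReN z : Re (- z) = - Re z. Proof. by case: z. Qed.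
Lemma cImN z : Im (- z) = - Im z. Proof. by case: z. Qed.
Lemma cReM z w : Re (z * w) = Re z * Re w - Im z * Im w.
Proof. by case: z; case: w. Qed.
Lemma cImM z w : Im (z * w) = Re z * Im w + Im z * Re w.
Proof. by case: z; case: w. Qed.

Lemma cRe_sum (I : Type) (r : seq I) (P : pred I) (F : I -> R[i]) :
  Re (\sum_(i <- r | P i) F i) = \sum_(i <- r | P i) Re (F i).
Proof. by elim/big_rec2: _ => // i y z _ <-; rewrite cReD. Qed.

Lemma complex_eq z w : Re z = Re w -> Im z = Im w -> z = w.
Proof. by case: z; case: w => /= ? ? ? ? -> ->. Qed.

Lemma cexpD z w : cexp (z + w) = cexp z * cexp w.
Proof.
apply: complex_eq; rewrite /cexp ?cReM ?cImM /= cReD cImD expRD ?cosD ?sinD;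
  ring.
Qed.

Lemma cexp0 : cexp (0 : R[i]) = 1.
Proof. by rewrite /cexp /= expR0 cos0 sin0 mulr1 mulr0. Qed.

Lemma cexpN z : cexp (- z) = (cexp z)^-1.
Proof.
have h : cexp z * cexp (- z) = 1 by rewrite -cexpD subrr cexp0.
have z0 : cexp z != 0.
  by apply/eqP => z0; move: h; rewrite z0 mul0r => /esym/eqP; rewrite oner_eq0.
by apply: (mulfI z0); rewrite h divff.
Qed.

Lemma cexp_nat n z : cexp (n%:R * z) = cexp z ^+ n.
Proof.
elim: n => [|n ih]; first by rewrite mul0r cexp0.
by rewrite -addn1 natrD mulrDl mul1r cexpD ih addn1 exprSr.
Qed.

Lemma normc_cexp z : normc (cexp z) = expR (Re z).
Proof.
rewrite normc_sqrtE /= !exprMn -mulrDr cos2Dsin2 mulr1 sqrtr_sqr ger0_norm//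
  expR_ge0.
Qed.

Lemma clog_pos t : 0 < t -> clog t%:C = (ln t)%:C.
Proof.
move=> t0; rewrite /clog /carg [Im _]/= lexx normc_real ger0_norm ?ltW//.
by rewrite /= divff ?gt_eqF// acos1.
Qed.

Lemma cpow_pos t w : 0 < t -> cpow t%:C w = cexp (w * (ln t)%:C).
Proof. by move=> t0; rewrite /cpow clog_pos. Qed.

Lemma normc_cpow_pos t w : 0 < t -> normc (cpow t%:C w) = expR (Re w * ln t).
Proof.
by move=> t0; rewrite cpow_pos// normc_cexp cReM /= mulr0 subr0.
Qed.

Lemma normc_cpow_real z x : normc (cpow z x%:C) = expR (x * ln (normc z)).
Proof. by rewrite /cpow normc_cexp cReM /= mul0r subr0. Qed.

(** The norm of [R[i]^o] is itself complex-valued, and 0 < e in [R[i]] forces e to be real. This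
    equivalence brings every limit back to the real-valued modulus. *)
Lemma cvg_complexP (T : Type) (F : set_system T) {FF : Filter F}
    (u : T -> R[i]) (l : R[i]) :
  u @ F --> (l : R[i]^o) <->
  normc (u x - l) @[x --> F] --> (0 : R).
Proof.
split=> [ul|ul].
  apply/cvgrPdist_lt => e e0.
  move/(@cvgrPdist_lt _ R[i]^o) : ul => /(_ e%:C); rewrite ltcR => /(_ e0).
  apply: filterS => x; rewrite sub0r normrN [`|normc _|]ger0_norm ?normc_ge0//.
  by rewrite distrC normr_complexE ltcR.
apply/(@cvgrPdist_lt _ R[i]^o) => -[e e'] e0.
move: e0; rewrite ltcE /= => /andP[/eqP -> e0].
move/cvgrPdist_lt : ul => /(_ e e0); apply: filterS => x.
rewrite sub0r normrN [`|normc _|]ger0_norm ?normc_ge0//.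
by move=> h; rewrite distrC normr_complexE ltcE /= eqxx.
Qed.

Lemma cvg_Re_Im (T : Type) (F : set_system T) {FF : Filter F}
    (u : T -> R[i]) (l : R[i]) :
  u @ F --> (l : R[i]^o) <->
  Re (u x) @[x --> F] --> Re l /\ Im (u x) @[x --> F] --> Im l.
Proof.
split=> [/cvg_complexP ul|[ur ui]].
  by split; apply/cvgrPdist_lt => e e0;
    move/cvgrPdist_lt : ul => /(_ e e0); apply: filterS => x;
    rewrite sub0r normrN ger0_norm ?normc_ge0// distrC => h;
    apply: le_lt_trans h; rewrite -?cReN -?cImN -?cReD -?cImD;
    [exact: normr_Re_le|exact: normr_Im_le].
apply/cvg_complexP/cvgrPdist_lt => e e0.
have e20 : 0 < e / 2 by rewrite divr_gt0.
move/cvgrPdist_lt : ur => /(_ _ e20) ur.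
move/cvgrPdist_lt : ui => /(_ _ e20) ui.
apply: filterS2 ur ui => x h1 h2.
rewrite sub0r normrN ger0_norm ?normc_ge0//.
rewrite (le_lt_trans (normc_le_ReIm _))// cReD cImD cReN cImN (splitr e).
by rewrite distrC [X in _ + X]distrC ltrD.
Qed.

Lemma cvg_complexMl (T : Type) (F : set_system T) {FF : Filter F}
    (u : T -> R[i]) (l z : R[i]) :
  u @ F --> (l : R[i]^o) -> u p * z @[p --> F] --> (l * z : R[i]^o).
Proof.
move=> /cvg_complexP ul; apply/cvg_complexP.
have : normc (u p - l) * normc z @[p --> F] --> 0 * normc z.
  by apply: cvgM => //; exact: cvg_cst.
rewrite mul0r; set S := (X in X @ _ --> _ -> _).
have -> // : S = (fun p => normc (u p * z - l * z)).
by apply/funext => p; rewrite /S -mulrBl ComplexField.Normc.normcM.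
Qed.

(** A quadratic remainder is an estimate that survives integration. It yields complex
    differentiability of a Mellin integral without the Cauchy-Riemann equations. *)
Lemma derivable_complex (g : R[i] -> R[i]) z l (C : R) :
  (forall h, normc h <= 1 ->
     normc (g (h + z) - g z - h * l) <= C * normc h ^+ 2) ->
  derivable (g : R[i]^o -> R[i]^o) z 1.
Proof.
move=> H; apply/cvg_ex; exists (l : R[i]^o).
apply/cvg_complexP/cvgrPdist_lt => e e0.
(* The 1 keeps h in the range of the hypothesis; adding 1 to |C| keeps the denominator positive when
   C = 0. *)
pose d := Num.min 1 (e / (`|C| + 1)).
have C1 : 0 < `|C| + 1 by rewrite ltr_wpDl.
have d0 : 0 < d by rewrite lt_min ltr01 divr_gt0.
apply/nbhs_ballP; exists d%:C => /=; first by rewrite ltcR.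
move=> h; rewrite /ball /= sub0r normrN normr_complexE ltcR => hd h0.
rewrite sub0r normrN ger0_norm ?normc_ge0// /shift /= .
have nh0 : 0 < normc h.
  rewrite lt_neqAle normc_ge0 andbT eq_sym.
  by apply: contra h0 => /eqP/ComplexField.Normc.eq0_normc ->.
have -> : h^-1 *: (g (h *: (1 : R[i]^o) + z) - g z) - l =
    h^-1 * (g (h + z) - g z - h * l).
  have -> : h *: (1 : R[i]^o) = h by rewrite -[RHS]mulr1.
  rewrite [_ *: _]/(_ * _) [in RHS]mulrBr mulrA mulVf// mul1r //.
rewrite ComplexField.Normc.normcM ComplexField.Normc.normcV.
rewrite ltr_pdivrMl//; move: hd; rewrite lt_min => /andP[h1 h2].
apply: (le_lt_trans (H _ (ltW h1))).
rewrite expr2 mulrA mulrC ltr_pM2l//.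
rewrite (@le_lt_trans _ _ (`|C| * normc h))//.
  by rewrite ler_wpM2r ?normc_ge0// ler_norm.
move: h2; rewrite ltr_pdivlMr// => h2; apply: le_lt_trans h2.
by rewrite mulrC ler_wpM2l ?normc_ge0// lerDl.
Qed.

(** A mean value theorem at 0 valid for both signs of x. Applied repeatedly, it turns a bound on the
    derivative into a Taylor remainder of one order higher. *)
Lemma mvt0 (g dg : R -> R) x : (forall y, is_derive y 1 g (dg y)) ->
  exists2 c, `|c| <= `|x| & g x - g 0 = dg c * x.
Proof.
move=> dgE.
have cg : continuous g.
  by move=> y; apply/differentiable_continuous/derivable1_diffP/ex_derive.
have [x0|x0] := leP 0 x.
  have [|c] := @MVT_segment _ g dg 0 x x0.
    exact: continuous_subspaceT.
  rewrite in_itv /= => /andP[c0 cx] ->; exists c; last by rewrite subr0.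
  by rewrite !ger0_norm.
have [|c] := @MVT_segment _ g dg x 0 (ltW x0).
  exact: continuous_subspaceT.
rewrite in_itv /= => /andP[c0 cx] e; exists c.
  by rewrite !ler0_norm ?lerN2// ltW.
by rewrite -opprB e sub0r mulrN opprK.
Qed.

Lemma sin_norm_le x : `|sin x| <= `|x|.
Proof.
have [c _] := @mvt0 sin cos x (fun y => is_derive_sin y).
rewrite sin0 subr0 => ->; rewrite normrM ler_piMl//; exact: cos_max.
Qed.

Lemma cos_sub1_norm_le x : `|cos x - 1| <= `|x|.
Proof.
have [c _] := @mvt0 cos (fun y => - sin y) x (fun y => is_derive_cos y).
rewrite cos0 => ->; rewrite normrM normrN ler_piMl//; exact: sin_max.
Qed.

Lemma cos_sub1_norm_le_sqr x : `|cos x - 1| <= `|x| ^+ 2.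
Proof.
have [c cx] := @mvt0 cos (fun y => - sin y) x (fun y => is_derive_cos y).
rewrite cos0 => ->; rewrite normrM normrN expr2 ler_wpM2r//.
by rewrite (le_trans (sin_norm_le _)).
Qed.

Lemma sin_subx_norm_le x : `|sin x - x| <= `|x| ^+ 2.
Proof.
have [c cx] := @mvt0 (fun y => sin y - y) (fun y => cos y - 1) x _.
rewrite sin0 subr0 subr0 => ->; rewrite normrM expr2 ler_wpM2r//.
by rewrite (le_trans (cos_sub1_norm_le _)).
Qed.

Lemma expR_sub1_norm_le x : `|expR x - 1| <= `|x| * expR `|x|.
Proof.
have [c cx] := @mvt0 expR expR x (fun y => is_derive_expR y).
rewrite expR0 => ->; rewrite normrM mulrC ler_wpM2l//.
by rewrite ger0_norm ?expR_ge0// ler_expR (le_trans (ler_norm _)).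
Qed.

Lemma expR_sub1x_norm_le x : `|expR x - 1 - x| <= `|x| ^+ 2 * expR `|x|.
Proof.
have [|c cx] := @mvt0 (fun y => expR y - 1 - y) (fun y => expR y - 1) x.
  move=> y; apply: is_deriveB; rewrite -[X in is_derive _ _ _ X]subr0.
  by apply: is_deriveB.
rewrite expR0 subrr subr0 subr0 => ->; rewrite normrM expr2 mulrAC ler_wpM2r//.
rewrite (le_trans (expR_sub1_norm_le _))// ler_pM ?expR_ge0//.
by rewrite ler_expR.
Qed.

(** The real and imaginary parts each split into two one-variable Taylor remainders, all four at
    most N^2 e^N; the constant 5 leaves one unit of slack. *)
Lemma normc_cexp_sub1x z :
  normc (cexp z - 1 - z) <= 5 * normc z ^+ 2 * expR (normc z).
Proof.
rewrite (le_trans (normc_le_ReIm _))// !cReD !cImD !cReN !cImN /=.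
set x := Re z; set y := Im z; set E := expR (normc z); set N := normc z.
have E0 : 0 < E by exact: expR_gt0.
have xN : `|x| <= N by exact: normr_Re_le.
have yN : `|y| <= N by exact: normr_Im_le.
have xE : expR x <= E by rewrite ler_expR (le_trans (ler_norm _)).
have nxE : expR `|x| <= E by rewrite ler_expR.
have x2 : `|x| ^+ 2 <= N ^+ 2 by rewrite ler_sqr ?nnegrE ?normc_ge0.
have y2 : `|y| ^+ 2 <= N ^+ 2 by rewrite ler_sqr ?nnegrE ?normc_ge0.
have N0 : 0 <= N ^+ 2 by exact: sqr_ge0.
have -> : expR x * cos y - 1 - x = expR x * (cos y - 1) + (expR x - 1 - x).
  by ring.
have -> : expR x * sin y - 0 - y = expR x * (sin y - y) + (expR x - 1) * y.
  by ring.
have h1 : `|expR x * (cos y - 1)| <= N ^+ 2 * E.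
  rewrite normrM mulrC [`|expR x|]ger0_norm ?expR_ge0// ler_pM ?expR_ge0//.
  by rewrite (le_trans (cos_sub1_norm_le_sqr _)).
have h2 : `|expR x - 1 - x| <= N ^+ 2 * E.
  by rewrite (le_trans (expR_sub1x_norm_le _))// ler_pM ?expR_ge0.
have h3 : `|expR x * (sin y - y)| <= N ^+ 2 * E.
  rewrite normrM mulrC [`|expR x|]ger0_norm ?expR_ge0// ler_pM ?expR_ge0//.
  by rewrite (le_trans (sin_subx_norm_le _)).
have h4 : `|(expR x - 1) * y| <= N ^+ 2 * E.
  rewrite normrM expr2 mulrAC ler_pM// (le_trans (expR_sub1_norm_le _))//.
  by rewrite ler_pM ?expR_ge0.
have := ler_normD (expR x * (cos y - 1)) (expR x - 1 - x).
have := ler_normD (expR x * (sin y - y)) ((expR x - 1) * y).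
have : 0 <= N ^+ 2 * E by rewrite mulr_ge0// ltW.
rewrite -mulrA; lra.
Qed.

End ComplexBasics.

(** * Integration on the positive half-line *)

Section Inversion.
Variable R : realType.
Local Notation mu := (@lebesgue_measure R).
Local Notation T := (measurableTypeR R).
Local Notation E := (`]0%R, +oo[%classic : set T).
Implicit Types (A : set T).

Lemma measurable_pos_inv : measurable_fun E (@GRing.inv R).
Proof.
apply: open_continuous_measurable_fun; first exact: interval_open.
move=> x; rewrite inE /= in_itv /= andbT => x0.
by apply: inv_continuous; rewrite gt_eqF.
Qed.

Let w (x : T) : R := x^-1 ^+ 2.

Let w_ge0 x : 0 <= w x. Proof. exact: sqr_ge0. Qed.

Let mw : measurable_fun E w.
Proof. by apply: measurable_funX; exact: measurable_pos_inv. Qed.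

Let pre A := E `&` (@GRing.inv R @^-1` A).

Let mpre A : measurable A -> measurable (pre A).
Proof. by move=> mA; apply: measurable_pos_inv. Qed.

(** The image under x -> 1 / x of the density x^-2 on the positive half-line. Once it is a measure,
    the substitution formula follows from the uniqueness of Lebesgue measure. *)
Definition inversion_measure A : \bar R :=
  (\int[mu]_(x in E `&` (@GRing.inv R @^-1` A)) (x^-1 ^+ 2)%:E)%E.

Let mwpre A : measurable_fun (pre A) (fun x => (w x)%:E).
Proof. by apply/measurable_EFinP; apply: measurable_funS mw => // x []. Qed.

Let im0 : inversion_measure set0 = 0%E.
Proof. by rewrite /inversion_measure preimage_set0 setI0 integral_set0. Qed.

Let im_ge0 A : (0 <= inversion_measure A)%E.
Proof. by apply: integral_ge0 => x _; rewrite lee_fin w_ge0. Qed.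

Let im_sigma_additive : semi_sigma_additive inversion_measure.
Proof.
move=> /= F mF tF mUF; rewrite /inversion_measure; apply: cvg_toP.
  apply: ereal_nondecreasing_is_cvgn => m n mn.
  by apply: lee_sum_nneg_natr => // k _ _; exact: im_ge0.
rewrite preimage_bigcup setI_bigcupr ge0_integral_bigcup//=.
- by move=> k; exact: mpre.
- by rewrite -setI_bigcupr -preimage_bigcup; exact: mwpre.
- by move=> x _; rewrite lee_fin w_ge0.
- apply/trivIsetP => /= i j _ _ ij.
  rewrite setIACA setIid -preimage_setI.
  by move/trivIsetP : tF => /(_ _ _ _ _ ij) ->//; rewrite preimage_set0 setI0.
Qed.

HB.instance Definition _ := isMeasure.Build _ _ _
  inversion_measure im0 im_ge0 im_sigma_additive.

Lemma integral_inv_sqr (c : R) : 0 < c ->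
  (\int[mu]_(x in `[c, +oo[) (x^-1 ^+ 2)%:E = (c^-1)%:E)%E.
Proof.
move=> c0.
have dV (x : R) : 0 < x -> is_derive x 1 (fun y : R => - y^-1) (x^-1 ^+ 2).
  move=> x0; apply: is_derive_eq; first by apply: is_deriveN;
    apply: is_deriveV; rewrite gt_eqF.
  by rewrite scaler1 opprK exprVn.
rewrite (@ge0_continuous_FTC2y R (fun x => x^-1 ^+ 2) (fun x => - x^-1) c 0).
- by rewrite -EFinB sub0r opprK.
- by move=> x _; exact: sqr_ge0.
- apply: continuous_in_subspaceT => x; rewrite inE /= in_itv /= andbT => cx.
  have x0 : x != 0 by rewrite gt_eqF// (lt_le_trans c0).
  apply: (@continuous_comp _ _ _ (@GRing.inv R) (fun x => x ^+ 2)).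
    exact: inv_continuous.
  exact: exprn_continuous.
- rewrite -[X in _ --> X]oppr0; apply: cvgN.
  apply/(@cvgrPdist_le _ R) => e e0; near=> x.
  have x0 : 0 < x by near: x; exact: nbhs_pinfty_gt.
  rewrite sub0r normrN ger0_norm; last by rewrite invr_ge0 ltW.
  rewrite invf_ple ?posrE//.
- by move=> x cx; have := dV x (lt_trans c0 cx) => -[].
- apply: cvg_at_right_filter; apply: cvgN; apply: inv_continuous.
  by rewrite gt_eqF.
- move=> x; rewrite in_itv /= andbT => cx.
  by rewrite derive1E; have [_] := dV x (lt_trans c0 cx).
Unshelve. all: by end_near. Qed.

(* Both sides agree on half-open intervals, where the right-hand side is computed
   by the fundamental theorem of calculus. *)
Lemma inversion_measureE A : measurable A ->
  mu (A `&` E) = inversion_measure A.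
Proof.
have mN : measurable (`]-oo, 0%R]%classic : set (measurableTypeR R)).
  exact: measurable_itv.
(* Uniqueness concerns measures on the whole line, so Lebesgue measure on the nonpositive half is
   added. *)
pose m : {measure set (measurableTypeR R) -> \bar R} :=
  measure_add (mrestr mu mN) inversion_measure.
have mE B : m B = (mu (B `&` `]-oo, 0%R]) + inversion_measure B)%E.
  exact: (measure_addE (mrestr mu mN) inversion_measure B).
have key X : ocitv X -> mu X = m X.
  move=> [[a b] _ /=] <-; rewrite mE.
  have mab : measurable (`]a, b]%classic : set T) by exact: measurable_itv.
  have -> : mu `]a, b]%classic =
      (mu (`]a, b]%classic `&` `]-oo, 0%R]) + mu (`]a, b]%classic `&` E))%E.
    rewrite -measureU; last 3 first.
    - by apply: measurableI.
    - by apply: measurableI.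
    - apply/seteqP; split => x //= [[_]] /[swap] -[_].
      by rewrite !in_itv /= andbT => x0 /(lt_le_trans x0); rewrite ltxx.
    congr (mu _); rewrite -setIUr; apply/seteqP; split => x /=; last by case.
    move=> xab; split => //; rewrite !in_itv /= andbT.
    by have [x0|x0] := leP x 0; [left|right].
  congr (_ + _)%E.
  pose a' := Num.max a 0.
  have a'0 : 0 <= a' by rewrite /a' le_max lexx orbT.
  have -> : `]a, b]%classic `&` E = `]a', b]%classic.
    apply/seteqP; split => x /=; rewrite !in_itv /= andbT /a' gt_max.
      by move=> [/andP[-> ->] ->].
    by move=> /andP[/andP[-> ->] ->].
  have -> : inversion_measure `]a, b]%classic =
      inversion_measure `]a', b]%classic.
    congr integral; apply/seteqP; split => x /=;
      rewrite !in_itv /= andbT /a' gt_max.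
      by move=> [x0 /andP[-> ->]]; rewrite invr_gt0 x0.
    by move=> [x0 /andP[/andP[-> _] ->]]; rewrite x0.
  rewrite lebesgue_measure_itv /= lte_fin; case: ltP => a'b; last first.
    rewrite set_itv_ge ?measure0// bnd_simp -leNgt//.
  have b0 : 0 < b by exact: le_lt_trans a'b.
  have preE (c : R) : 0 < c -> pre `]0%R, c]%classic = `[c^-1, +oo[%classic.
    move=> c0; rewrite /pre; apply/seteqP; split => x /=;
      rewrite !in_itv /= !andbT.
      by move=> [x0 /andP[_ h]]; rewrite invf_ple ?posrE.
    move=> h; have x0 : 0 < x by rewrite (lt_le_trans _ h)// invr_gt0.
    by rewrite x0 invr_gt0 x0/= invf_ple ?posrE.
  have imE (c : R) : 0 < c -> inversion_measure `]0%R, c]%classic = c%:E.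
    move=> c0; rewrite /inversion_measure -/(pre _) preE// integral_inv_sqr
      ?invr_gt0//.
    by rewrite invrK.
  (* An interval touching 0 has a half-line as preimage, which the improper integral settles; any
     other interval is a difference of two of these. *)
  move: a'0; rewrite le_eqVlt => /predU1P[<-|a'0].
    by rewrite imE// sube0.
  have : inversion_measure `]0%R, b]%classic =
     (inversion_measure `]0%R, a']%classic +
      inversion_measure `]a', b]%classic)%E.
    rewrite -measureU//.
    - congr inversion_measure; apply/seteqP; split => x /=; rewrite !in_itv /=.
        by move=> /andP[-> ->]; have [|] := leP x a'; [left|right].
      by move=> [/andP[-> /le_trans]|/andP[h ->]]; rewrite ?andbT; [apply;
        exact: ltW|exact: lt_trans h].
    - apply/seteqP; split => x //=;
      rewrite !in_itv /= => -[/andP[_ h] /andP[/(le_lt_trans h)]].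
      by rewrite ltxx.
  by rewrite !imE// => ->; rewrite addeAC -EFinB subrr add0e.
move=> mA; have mAE : measurable (A `&` E) by apply: measurableI.
rewrite (lebesgue_measure_unique key mAE) mE -setIA.
have -> : E `&` `]-oo, 0%R] = set0.
  apply/seteqP; split => x //=; rewrite !in_itv /= andbT.
  by move=> [x0 /(lt_le_trans x0)]; rewrite ltxx.
rewrite setI0 measure0 add0e; congr integral.
apply/seteqP; split => x /=; rewrite !in_itv /= !andbT => -[];
  first by move=> ? [].
by move=> x0 h; rewrite invr_gt0 x0.
Qed.

Import HBNNSimple.

(** On indicator functions this is [inversion_measureE]; linearity extends it to simple functions
    and monotone convergence to nonnegative measurable ones. *)
Lemma ge0_integral_inversion (g : T -> \bar R) :
  measurable_fun E g -> (forall x : R, (0 < x)%R -> (0 <= g x)%E) ->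
  (\int[mu]_(x in E) g x = \int[mu]_(x in E) (g (x^-1)%R * (x^-1 ^+ 2)%:E))%E.
Proof.
move=> mg g0.
have Einv x : E x -> E x^-1.
  by rewrite /= !in_itv /= !andbT invr_gt0.
have mE : measurable E by exact: measurable_itv.
have g0' x : E x -> (0 <= g x)%E.
  by rewrite /= in_itv /= andbT; exact: g0.
pose f_ : {nnsfun T >-> R}^nat := nnsfun_approx mE mg.
have mcomp (h : T -> R) : measurable_fun setT h ->
    measurable_fun E (fun x => (h x^-1)%:E).
  move=> mh; apply/measurable_EFinP.
  exact: (measurableT_comp mh measurable_pos_inv).
have mfi n : measurable_fun E (fun x => (f_ n x^-1)%:E) by exact: mcomp.
have mw' : measurable_fun E (fun x : R => (x^-1 ^+ 2)%:E).
  by apply/measurable_EFinP; exact: mw.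
transitivity (limn (fun n => \int[mu]_(x in E) (f_ n x)%:E))%E.
  rewrite -monotone_convergence//.
  - apply: eq_integral => y /[!inE] yD; apply/esym/cvg_lim => //.
    by apply: cvg_nnsfun_approx.
  - by move=> n; apply/measurable_EFinP/measurable_funTS.
  - by move=> n y _; rewrite lee_fin.
  - by move=> y _ m n mn; rewrite lee_fin; exact/lefP/nd_nnsfun_approx.
transitivity (limn (fun n =>
    \int[mu]_(x in E) ((f_ n x^-1)%:E * (x^-1 ^+ 2)%:E)))%E; last first.
  rewrite -monotone_convergence//.
  - apply: eq_integral => y /[!inE] yD; apply/cvg_lim => //.
    under eq_fun do rewrite muleC.
    rewrite muleC; apply: cvgeZl => //.
    by apply: cvg_nnsfun_approx => //; exact: Einv.
  - by move=> n; apply: emeasurable_funM.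
  - by move=> n y _; rewrite mule_ge0 ?lee_fin// w_ge0.
  - move=> y _ m n mn; rewrite lee_pmul ?lee_fin ?w_ge0//.
    by have /lefP := nd_nnsfun_approx mE mg mn; apply.
congr (limn _); apply/funext => n.
under eq_integral do rewrite fimfunE -fsumEFin//.
rewrite ge0_integral_fsum//; last 2 first.
- by move=> y; exact/measurable_EFinP/measurable_funM.
- by move=> y x _; rewrite nnfun_muleindic_ge0.
transitivity (\sum_(r \in range (f_ n))
  \int[mu]_(x in E) (r%:E * ((\1_(f_ n @^-1` [set r]) x^-1)%:E * (x^-1 ^+
    2)%:E)))%E.
  apply: eq_fsbigr => r _; rewrite integralZl_indic_nnsfun// integral_indic//=.
  have [r0|r0] := ltP r 0.
    rewrite preimage_nnfun0// set0I measure0 mule0.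
    by rewrite integral0_eq// => x _; rewrite indic0 mul0e mule0.
  rewrite inversion_measureE// ge0_integralZl//.
  - congr (_ * _)%E; rewrite /inversion_measure integral_mkcondr.
    apply: eq_integral => x _; rewrite patchE indicE.
    rewrite (_ : (x \in _) = (x^-1 \in f_ n @^-1` [set r])).
      by case: ifPn; rewrite ?mul1e ?mul0e.
    by apply/idP/idP; rewrite !inE.
  - by apply: emeasurable_funM => //; apply: mcomp.
  - by move=> x _; rewrite mule_ge0 ?lee_fin// w_ge0.
rewrite -ge0_integral_fsum//.
- apply: eq_integral => x _; rewrite fimfunE -fsumEFin//.
  rewrite ge0_mule_fsuml//.
    by apply: eq_fsbigr => r _; rewrite EFinM muleA.
  by move=> r; rewrite lee_fin; exact: nnfun_muleindic_ge0.
- move=> r; apply: emeasurable_funM => //; apply: emeasurable_funM => //.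
  exact: mcomp.
- move=> r x _; rewrite muleA mule_ge0 ?lee_fin ?w_ge0//.
  exact: nnfun_muleindic_ge0.
Qed.

End Inversion.

(** * Complex-valued integrals over the positive half-line *)

Section HalfLineIntegral.
Variable R : realType.
Local Notation mu := (@lebesgue_measure R).
Local Notation E := (`]0%R, +oo[%classic : set (measurableTypeR R)).
Implicit Types (g h : R -> R[i]) (t x : R).

Definition cmeasurable g : Prop :=
  measurable_fun E (fun t => Re (g t)) /\ measurable_fun E (fun t => Im (g t)).

Definition cintegrable g : Prop :=
  mu.-integrable E (fun t => (Re (g t))%:E) /\
  mu.-integrable E (fun t => (Im (g t))%:E).

Definition cint g : R[i] :=
  (\int[mu]_(t in E) Re (g t)) +i* (\int[mu]_(t in E) Im (g t)).

Lemma mem_halfline t : E t <-> 0 < t.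
Proof. by rewrite /= in_itv /= andbT. Qed.

Lemma measurable_halfline : measurable E. Proof. exact: measurable_itv. Qed.
Hint Resolve measurable_halfline : core.

Lemma measurable_fun_eq (u v : R -> R) : (forall t, 0 < t -> u t = v t) ->
  measurable_fun E u -> measurable_fun E v.
Proof.
move=> uv; apply: eq_measurable_fun => t; rewrite inE => /mem_halfline.
exact: uv.
Qed.

Lemma eq_cmeasurable g h : (forall t, 0 < t -> g t = h t) ->
  cmeasurable g -> cmeasurable h.
Proof.
by move=> gh [g1 g2]; split; [apply: measurable_fun_eq g1|
  apply: measurable_fun_eq g2] => t t0; rewrite gh.
Qed.

Lemma cmeasurable_cst (z : R[i]) : cmeasurable (fun=> z).
Proof. by split; exact: measurable_cst. Qed.

Lemma cmeasurable_real (u : R -> R) :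
  measurable_fun E u -> cmeasurable (fun t => (u t)%:C).
Proof. by move=> mu; split => //; exact: measurable_cst. Qed.

Lemma cmeasurableD g h : cmeasurable g -> cmeasurable h ->
  cmeasurable (fun t => g t + h t).
Proof.
move=> [g1 g2] [h1 h2]; split.
  by apply: (measurable_fun_eq _ (measurable_funD g1 h1)) => t _; rewrite cReD.
by apply: (measurable_fun_eq _ (measurable_funD g2 h2)) => t _; rewrite cImD.
Qed.

Lemma cmeasurableM g h : cmeasurable g -> cmeasurable h ->
  cmeasurable (fun t => g t * h t).
Proof.
move=> [g1 g2] [h1 h2]; split.
  apply: (measurable_fun_eq _ (measurable_funB (measurable_funM g1 h1)
    (measurable_funM g2 h2))) => t _; by rewrite cReM.
apply: (measurable_fun_eq _ (measurable_funD (measurable_funM g1 h2)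
  (measurable_funM g2 h1))) => t _; by rewrite cImM.
Qed.

Lemma cmeasurable_sum n (F : 'I_n -> R -> R[i]) :
  (forall i, cmeasurable (F i)) -> cmeasurable (fun t => \sum_(i < n) F i t).
Proof.
move=> mF; rewrite unlock; elim: (index_enum _) => [|i r ih] /=.
  exact: cmeasurable_cst.
exact: cmeasurableD.
Qed.

Lemma cmeasurable_cexp g : cmeasurable g -> cmeasurable (fun t => cexp (g t)).
Proof.
move=> [g1 g2]; split => /=; apply: measurable_funM.
- exact: measurableT_comp.
- by apply: measurableT_comp g2 => //;
    apply: continuous_measurable_fun; exact: continuous_cos.
- exact: measurableT_comp.
- by apply: measurableT_comp g2 => //;
    apply: continuous_measurable_fun; exact: continuous_sin.
Qed.

Lemma measurable_ln_halfline : measurable_fun E (fun t : R => ln t).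
Proof. by apply: measurable_funTS; exact: measurable_ln. Qed.

Lemma cmeasurable_cpow (w : R[i]) : cmeasurable (fun t => cpow t%:C w).
Proof.
apply: (@eq_cmeasurable (fun t => cexp (w * (ln t)%:C))).
  by move=> t t0; rewrite cpow_pos.
apply: cmeasurable_cexp; apply: cmeasurableM; first exact: cmeasurable_cst.
by apply: cmeasurable_real; exact: measurable_ln_halfline.
Qed.

Lemma cmeasurable_inv g : cmeasurable g -> cmeasurable (fun t => g t^-1).
Proof.
have h (u : R -> R) : measurable_fun E u -> measurable_fun E (fun t => u t^-1).
  move=> mu; apply: (measurable_comp measurable_halfline _ mu
    (@measurable_pos_inv R)).
  by move=> _ [t /mem_halfline t0 <-]; apply/mem_halfline; rewrite invr_gt0.
by move=> [g1 g2]; split; [exact: (h (fun t => Re (g t)))|exact: (h (fun t =>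
  Im (g t)))].
Qed.

Lemma measurable_normc g : cmeasurable g ->
  measurable_fun E (fun t => normc (g t)).
Proof.
move=> [m1 m2].
apply: (@measurable_fun_eq (fun t => Num.sqrt (Re (g t) ^+ 2 + Im (g t) ^+ 2))).
  by move=> t _; rewrite normc_sqrtE.
have msqrt := continuous_measurable_fun (@sqrt_continuous R).
have m12 : measurable_fun E (fun t => Re (g t) ^+ 2 + Im (g t) ^+ 2).
  by apply: measurable_funD; exact: measurable_funX.
exact: (measurableT_comp msqrt m12).
Qed.

Lemma eq_integrable_halfline (u v : R -> R) : (forall t, 0 < t -> u t = v t) ->
  mu.-integrable E (fun t => (u t)%:E) -> mu.-integrable E (fun t => (v t)%:E).
Proof.
move=> uv; apply: eq_integrable => // t; rewrite inE => /mem_halfline t0.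
by rewrite uv.
Qed.

Lemma eq_cint g h : (forall t, 0 < t -> g t = h t) -> cint g = cint h.
Proof.
move=> gh; rewrite /cint; congr (_ +i* _); apply: eq_Rintegral => t;
  by rewrite inE => /mem_halfline t0; rewrite gh.
Qed.

Lemma cintegrable_dom g (u : R -> R) : cmeasurable g ->
  (forall t, 0 < t -> normc (g t) <= u t) ->
  mu.-integrable E (fun t => (u t)%:E) -> cintegrable g.
Proof.
move=> [g1 g2] gu iu.
split; apply: (le_integrable measurable_halfline _ _ iu).
- exact/measurable_EFinP.
- move=> t /mem_halfline t0; rewrite /= lee_fin.
  by rewrite (le_trans (normr_Re_le _))// (le_trans (gu _ t0))// ler_norm.
- exact/measurable_EFinP.
- move=> t /mem_halfline t0; rewrite /= lee_fin.
  by rewrite (le_trans (normr_Im_le _))// (le_trans (gu _ t0))// ler_norm.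
Qed.

Lemma cintD g h : cintegrable g -> cintegrable h ->
  cint (fun t => g t + h t) = cint g + cint h.
Proof.
move=> [g1 g2] [h1 h2]; rewrite /cint; apply: complex_eq;
  rewrite ?cReD ?cImD /=.
  by rewrite -RintegralD//; apply: eq_Rintegral => t _; rewrite cReD.
by rewrite -RintegralD//; apply: eq_Rintegral => t _; rewrite cImD.
Qed.

Lemma cintegrableD g h : cintegrable g -> cintegrable h ->
  cintegrable (fun t => g t + h t).
Proof.
move=> [g1 g2] [h1 h2]; split.
  apply: (@eq_integrable_halfline (fun t => Re (g t) + Re (h t))) => [t _|].
    by rewrite cReD.
  exact: (integrableD measurable_halfline g1 h1).
apply: (@eq_integrable_halfline (fun t => Im (g t) + Im (h t))) => [t _|].
  by rewrite cImD.
exact: (integrableD measurable_halfline g2 h2).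
Qed.

Lemma cintegrableZ (z : R[i]) g : cintegrable g ->
  cintegrable (fun t => z * g t).
Proof.
move=> [g1 g2]; split.
  apply: (@eq_integrable_halfline
    (fun t => Re z * Re (g t) - Im z * Im (g t))) => [t _|].
    by rewrite cReM.
  exact: (integrableB measurable_halfline (integrableZl measurable_halfline _
    g1)
    (integrableZl measurable_halfline _ g2)).
apply: (@eq_integrable_halfline
  (fun t => Re z * Im (g t) + Im z * Re (g t))) => [t _|].
  by rewrite cImM.
exact: (integrableD measurable_halfline (integrableZl measurable_halfline _ g2)
  (integrableZl measurable_halfline _ g1)).
Qed.

Lemma cintZ (z : R[i]) g : cintegrable g ->
  cint (fun t => z * g t) = z * cint g.
Proof.
move=> [g1 g2].
have iZ (a : R) (u : R -> R) : mu.-integrable E (fun t => (u t)%:E) ->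
    mu.-integrable E (fun t => (a * u t)%:E).
  by move=> iu; exact: (integrableZl measurable_halfline a iu).
rewrite /cint; apply: complex_eq; rewrite ?cReM ?cImM /=.
  rewrite -!RintegralZl// -RintegralB//; [|exact: iZ|exact: iZ].
  by apply: eq_Rintegral => t _; rewrite cReM.
rewrite -!RintegralZl// -RintegralD//; [|exact: iZ|exact: iZ].
by apply: eq_Rintegral => t _; rewrite cImM.
Qed.

Lemma cintN g : cintegrable g -> cint (fun t => - g t) = - cint g.
Proof.
move=> ig; rewrite -mulN1r -cintZ//; apply: eq_cint => t _.
by rewrite mulN1r.
Qed.

Lemma cintegrableN g : cintegrable g -> cintegrable (fun t => - g t).
Proof.
move=> ig; under eq_fun do rewrite -mulN1r; exact: cintegrableZ.
Qed.

Lemma cint0 : cint (fun=> 0) = 0.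
Proof. by rewrite /cint /Rintegral integral0. Qed.

Lemma cintegrable0 : cintegrable (fun=> 0).
Proof. by split => /=; exact: integrable0. Qed.

Lemma cint_sum n (F : 'I_n -> R -> R[i]) : (forall i, cintegrable (F i)) ->
  cint (fun t => \sum_(i < n) F i t) = \sum_(i < n) cint (F i).
Proof.
move=> iF.
suff [_ ->//] : cintegrable (fun t => \sum_(i < n) F i t) /\
  cint (fun t => \sum_(i < n) F i t) = \sum_(i < n) cint (F i).
rewrite unlock; elim: (index_enum _) => [|i r [ih1 ih2]] /=.
  by rewrite cint0; split => //; exact: cintegrable0.
by rewrite cintD// ih2; split => //; exact: cintegrableD.
Qed.

(** The factor 2 appears because the real and imaginary parts are bounded separately. *)
Lemma normc_cint g (u : R -> R) : cintegrable g ->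
  (forall t, 0 < t -> normc (g t) <= u t) ->
  mu.-integrable E (fun t => (u t)%:E) ->
  normc (cint g) <= 2 * \int[mu]_(t in E) u t.
Proof.
move=> [g1 g2] gu iu; rewrite (le_trans (normc_le_ReIm _))//=.
rewrite mulr_natl mulr2n lerD//.
  rewrite (le_trans (le_normr_Rintegral _ g1))// le_Rintegral//.
    exact: integrable_norm.
  by move=> t /mem_halfline t0; rewrite (le_trans (normr_Re_le _))// gu.
rewrite (le_trans (le_normr_Rintegral _ g2))// le_Rintegral//.
  exact: integrable_norm.
by move=> t /mem_halfline t0; rewrite (le_trans (normr_Im_le _))// gu.
Qed.

(** Up to the factor D / c this is the density of the exponential distribution. *)
Lemma integrable_expR_decay (D c : R) : 0 < c ->
  mu.-integrable E (fun t => (D * expR (- (c * t)))%:E).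
Proof.
move=> c0.
have h := integrable_exponential_pdf c0.
have h' : mu.-integrable E (EFin \o exponential_pdf c).
  by apply: integrableS h.
have := integrableZl measurable_halfline (D / c) h'.
apply: eq_integrable => // t; rewrite inE => /mem_halfline t0.
rewrite /= -EFinM exponential_pdfE ?ltW//; congr (_%:E).
by rewrite mulrA divfK ?gt_eqF// mulNr.
Qed.

(** Positive and negative parts transform separately, so the extended integrals coincide and
    measurability alone suffices. *)
Lemma Rintegral_inversion (u : R -> R) : measurable_fun E u ->
  \int[mu]_(t in E) u t = \int[mu]_(t in E) (u t^-1 * t^-1 ^+ 2).
Proof.
move=> mu'; rewrite /Rintegral; congr fine.
have mE : measurable_fun E (EFin \o u) by exact/measurable_EFinP.
rewrite integralE [RHS]integralE.
rewrite (ge0_integral_inversion (measurable_funepos mE))//.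
rewrite (ge0_integral_inversion (measurable_funeneg mE))//.
congr (_ - _)%E; apply: eq_integral => t _; rewrite ?funeposE ?funenegE /=.
  rewrite EFinM -{2}[0%E](mul0e (t^-1 ^+ 2)%:E) maxe_pMl// ?lee_fin ?sqr_ge0//.
by rewrite -mulNr EFinM -{2}[0%E](mul0e (t^-1 ^+ 2)%:E) maxe_pMl// ?lee_fin
  ?sqr_ge0.
Qed.

Lemma cint_inversion g : cmeasurable g ->
  cint g = cint (fun t => g t^-1 * (t^-1 ^+ 2)%:C).
Proof.
move=> [g1 g2]; rewrite /cint Rintegral_inversion// [X in _ +i*
  X]Rintegral_inversion//.
by congr (_ +i* _); apply: eq_Rintegral => t _;
  rewrite ?cReM ?cImM /= mulr0 ?subr0 ?add0r.
Qed.

End HalfLineIntegral.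

(** * Rapidly decreasing functions and their Mellin transforms *)

Section RapidDecay.
Variable R : realType.
Local Notation mu := (@lebesgue_measure R).
Local Notation E := (`]0%R, +oo[%classic : set (measurableTypeR R)).
Implicit Types (g h : R -> R[i]) (t x c : R).

(* The symmetric exponent makes the class stable under t -> 1 / t and, at the
   cost of lowering c, under multiplication by powers of t. *)
Definition rapid c g : Prop := cmeasurable g /\
  exists D, forall t, 0 < t -> normc (g t) <= D * expR (- (c * (t + t^-1))).

Lemma rapid_integrable c g : 0 < c -> rapid c g -> cintegrable g.
Proof.
move=> c0 [mg [D gD]].
apply: (@cintegrable_dom _ g (fun t => `|D| * expR (- (c * t)))) => //;
  last first.
  exact: integrable_expR_decay.
move=> t t0; rewrite (le_trans (gD _ t0))// ler_pM ?expR_ge0 ?ler_norm//.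
- by have := le_trans (normc_ge0 _) (gD _ t0); rewrite pmulr_lge0// expR_gt0.
- by rewrite ler_expR lerN2 ler_pM2l// lerDl invr_ge0 ltW.
Qed.

(** The logarithm is sublinear at infinity, which settles p >= 0; replacing t by 1 / t settles p <
    0. This is how powers of t are absorbed into e^(e (t + 1 / t)). *)
Lemma mul_ln_le (p e : R) : 0 < e ->
  exists K, forall t, 0 < t -> p * ln t <= K + e * (t + t^-1).
Proof.
move=> e0.
have pos (q : R) : 0 <= q ->
    exists K, forall t, 0 < t -> q * ln t <= K + e * t.
  move=> q0; pose d := e / (q + 1).
  have q1 : 0 < q + 1 by rewrite ltr_wpDl.
  have d0 : 0 < d by rewrite divr_gt0.
  exists (- (q * ln d)) => t t0.
  have -> : q * ln t = - (q * ln d) + q * ln (d * t).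
    by rewrite lnM ?posrE//; ring.
  rewrite lerD2l (@le_trans _ _ (q * (d * t)))//.
    by rewrite ler_wpM2l// ltW// ln_sublinear// mulr_gt0.
  rewrite mulrA ler_pM2r// /d mulrA ler_pdivrMr// mulrC ler_pM2l//.
  by rewrite lerDl.
have [p0|p0] := leP 0 p.
  have [K H] := pos _ p0; exists K => t t0.
  by rewrite (le_trans (H t t0))// lerD2l ler_pM2l// lerDl invr_ge0 ltW.
have [|K H] := pos (- p); first by rewrite oppr_ge0 ltW.
exists K => t t0; have := H t^-1; rewrite invr_gt0 => /(_ t0).
rewrite lnV ?posrE// mulrNN => /le_trans; apply.
by rewrite lerD2l ler_pM2l// lerDr ltW.
Qed.

(** A factor e^(p |ln t|) costs an arbitrarily small part of c. As |ln t| is ln t or - ln t,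
    [mul_ln_le] is used with both p and - p. *)
Lemma rapidM c c' p K g h : c' < c -> rapid c g -> cmeasurable h ->
  (forall t, 0 < t -> normc (h t) <= K * expR (p * `|ln t|)) ->
  rapid c' (fun t => g t * h t).
Proof.
move=> cc [mg [D gD]] mh hK; split; first exact: cmeasurableM.
have d0 : 0 < c - c' by rewrite subr_gt0.
have [K1 H1] := mul_ln_le p d0; have [K2 H2] := mul_ln_le (- p) d0.
exists (`|D| * (`|K| * expR (`|K1| + `|K2|))) => t t0.
rewrite ComplexField.Normc.normcM.
have hle : normc (h t) <=
    `|K| * expR (`|K1| + `|K2|) * expR ((c - c') * (t + t^-1)).
  rewrite (le_trans (hK _ t0))// -mulrA -expRD.
  rewrite ler_pM ?expR_ge0 ?ler_norm//; last first.
    rewrite ler_expR.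
    have [l0|l0] := leP 0 (ln t).
      rewrite (ger0_norm l0) (le_trans (H1 _ t0))//
        lerD2r (le_trans (ler_norm _))//.
      by rewrite lerDl.
    rewrite (ltr0_norm l0) mulrN -mulNr (le_trans (H2 _ t0))// lerD2r.
    by rewrite (le_trans (ler_norm _))// lerDr.
  by have := le_trans (normc_ge0 _) (hK _ t0); rewrite pmulr_lge0// expR_gt0.
have gle : normc (g t) <= `|D| * expR (- (c * (t + t^-1))).
  by rewrite (le_trans (gD _ t0))// ler_wpM2r ?expR_ge0// ler_norm.
apply: (le_trans (ler_pM (normc_ge0 _) (normc_ge0 _) gle hle)).
have -> : expR (- (c' * (t + t^-1))) =
    expR (- (c * (t + t^-1))) * expR ((c - c') * (t + t^-1)).
  by rewrite -expRD; congr expR; ring.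
by rewrite le_eqVlt; apply/orP; left; apply/eqP; ring.
Qed.

Lemma normc_cpow_le t (w : R[i]) : 0 < t ->
  normc (cpow t%:C w) <= 1 * expR (`|Re w| * `|ln t|).
Proof.
move=> t0; rewrite normc_cpow_pos// mul1r ler_expR -normrM; exact: ler_norm.
Qed.

Lemma rapid_cpow c c' g (w : R[i]) : c' < c -> rapid c g ->
  rapid c' (fun t => g t * cpow t%:C w).
Proof.
move=> cc rg; apply: rapidM cc rg _ _; first exact: cmeasurable_cpow.
by move=> t t0; exact: normc_cpow_le.
Qed.

Lemma rapid_eq c g h : (forall t, 0 < t -> g t = h t) -> rapid c g -> rapid c h.
Proof.
move=> gh [mg [D gD]]; split; first exact: eq_cmeasurable mg.
by exists D => t t0; rewrite -gh// gD.
Qed.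

Lemma rapid_inv c g : rapid c g -> rapid c (fun t => g t^-1).
Proof.
move=> [mg [D gD]]; split; first exact: cmeasurable_inv.
exists D => t t0; have := gD t^-1; rewrite invr_gt0 => /(_ t0).
by rewrite invrK [t^-1 + t]addrC.
Qed.

Lemma rapidZ c (z : R[i]) g : rapid c g -> rapid c (fun t => z * g t).
Proof.
move=> [mg [D gD]]; split.
  by apply: cmeasurableM => //; exact: cmeasurable_cst.
exists (normc z * D) => t t0; rewrite ComplexField.Normc.normcM -mulrA.
by rewrite ler_wpM2l ?normc_ge0// gD.
Qed.

(** Trades the square for a doubled exponent, so that |ln t|^2 e^|ln t| takes a form that [rapidM]
    can absorb. *)
Lemma sqr_expR_le x : 0 <= x -> x ^+ 2 * expR x <= 2 * expR (2 * x).
Proof.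
move=> x0; have := expR_ge1Dxn 1 x0; rewrite /= => h.
have -> : 2 * x = x + x by ring.
rewrite expRD mulrA ler_wpM2r ?expR_ge0//.
have : x ^+ 2 / 2 <= expR x by rewrite (le_trans _ h)// lerDr.
by rewrite ler_pdivrMr// mulrC.
Qed.

(** The derivative is obtained under the integral sign: for |y| <= 1 the remainder t^y - 1 - y ln t
    is at most |y|^2 times 10 e^(2 |ln t|), which is independent of y and harmless against the decay
    of h. *)
Lemma mellin_entire c h : 0 < c -> rapid c h ->
  holomorphic_on setT (fun s => cint (fun t => h t * cpow t%:C (s - 1))).
Proof.
move=> c0 rh s _.
pose k t := h t * cpow t%:C (s - 1).
(* Half of c pays for t^(s-1); half of what remains pays for the logarithmic factors. *)
have rk : rapid (c / 2) k.
  by apply: rapid_cpow rh; rewrite ltr_pdivrMr// ltr_pMr// ltr1n.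
have c20 : 0 < c / 2 by rewrite divr_gt0.
have c40 : 0 < c / 4 by rewrite divr_gt0.
have c4 : c / 4 < c / 2 by rewrite ltr_pM2l// ltf_pV2 ?posrE// ltr_nat.
have mln : cmeasurable (fun t : R => (ln t)%:C).
  by apply: cmeasurable_real; exact: measurable_ln_halfline.
have rkl : rapid (c / 4) (fun t => k t * (ln t)%:C).
  apply: (rapidM (p := 1) (K := 1) c4 rk) => // t t0.
  rewrite normc_real !mul1r (le_trans _ (expR_ge1Dx _))//.
  by rewrite lerDr.
have [mkk [D HD]] : rapid (c / 4)
    (fun t => k t * (2 * expR (2 * `|ln t|))%:C).
  apply: (rapidM (p := 2) (K := 2) c4 rk).
    apply: cmeasurable_real; apply: measurable_funM => //.
    apply: measurableT_comp => //; apply: measurable_funM => //.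
    by apply: measurableT_comp => //; exact: measurable_ln_halfline.
  move=> t t0; rewrite normc_real ger0_norm// mulr_ge0// expR_ge0//.
have iD : mu.-integrable E (fun t => (`|D| * expR (- (c / 4 * t)))%:E).
  exact: integrable_expR_decay.
pose I := \int[mu]_(t in E) (`|D| * expR (- (c / 4 * t))).
(* The 5 is the constant of [normc_cexp_sub1x], the 2 that of [normc_cint]. *)
apply: (@derivable_complex _ _ s (cint (fun t => k t * (ln t)%:C)) (2 * (5 *
  I))).
move=> y y1.
have iy : cintegrable (fun t => h t * cpow t%:C (y + s - 1)).
  by apply: (rapid_integrable c20); apply: rapid_cpow rh;
    rewrite ltr_pdivrMr// ltr_pMr// ltr1n.
have ik : cintegrable k by exact: (rapid_integrable c20).
have ikl : cintegrable (fun t => k t * (ln t)%:C) by exact: (rapid_integrable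
  c40).
rewrite -cintN// -cintD//; last exact: cintegrableN.
rewrite -cintZ// -cintN; last exact: cintegrableZ.
rewrite -cintD//; last 2 first.
- by apply: cintegrableD => //; exact: cintegrableN.
- by apply: cintegrableN; exact: cintegrableZ.
have bound t : 0 < t ->
    normc (h t * cpow t%:C (y + s - 1) - k t - y * (k t * (ln t)%:C)) <=
    5 * normc y ^+ 2 * (`|D| * expR (- (c / 4 * t))).
  move=> t0.
  have -> : h t * cpow t%:C (y + s - 1) - k t - y * (k t * (ln t)%:C) =
      k t * (cexp (y * (ln t)%:C) - 1 - y * (ln t)%:C).
    rewrite /k !cpow_pos// -[y + s - 1]addrA mulrDl cexpD; ring.
  rewrite ComplexField.Normc.normcM.
  have N0 := normc_ge0 y.
  have b : normc (cexp (y * (ln t)%:C) - 1 - y * (ln t)%:C) <=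
      5 * normc y ^+ 2 * (2 * expR (2 * `|ln t|)).
    rewrite (le_trans (normc_cexp_sub1x _))//.
    rewrite ComplexField.Normc.normcM normc_real exprMn [5 * (_ * _)]mulrA.
    rewrite -[X in X <= _]mulrA ler_wpM2l ?mulr_ge0 ?sqr_ge0//.
    rewrite (le_trans _ (sqr_expR_le _))// ler_wpM2l ?sqr_ge0// ler_expR.
    by rewrite ler_piMl.
  rewrite (le_trans (ler_wpM2l (normc_ge0 _) b))//.
  rewrite mulrCA ler_wpM2l ?mulr_ge0 ?sqr_ge0//.
  have := HD t t0; rewrite ComplexField.Normc.normcM normc_real ger0_norm;
    last first.
    by rewrite mulr_ge0// expR_ge0.
  move=> /le_trans; apply.
  apply: (@le_trans _ _ (`|D| * expR (- (c / 4 * (t + t^-1))))).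
    by rewrite ler_wpM2r ?expR_ge0// ler_norm.
  by rewrite ler_wpM2l// ler_expR lerN2 ler_pM2l// lerDl invr_ge0 ltW.
apply: (le_trans (normc_cint _ bound _)).
- apply: cintegrableD; last by apply: cintegrableN; exact: cintegrableZ.
  by apply: cintegrableD => //; exact: cintegrableN.
- exact: (integrableZl (@measurable_halfline R) _ iD).
- rewrite RintegralZl//.
  by rewrite -/I le_eqVlt; apply/orP; left; apply/eqP; ring.
Qed.

End RapidDecay.

(** * Fourier expansions *)

Section IntegerSums.
Variable R : realType.
Implicit Types (g : int -> R[i]).

(** Once N >= P the terms below - P drop out; reversing the negative indices merges both halves into
    one sum of N + P terms running upwards from - P. *)
Lemma zpartialE g (P N : nat) : (forall n : int, n < - P%:Z -> g n = 0) ->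
  (P <= N)%N -> zpartial g N = \sum_(i < N + P) g (i%:Z - P%:Z).
Proof.
move=> g0 PN; rewrite addnC big_split_ord /= /zpartial [LHS]addrC;
  congr (_ + _).
  have -> : \sum_(i < N) g (- i.+1%:Z) = \sum_(0 <= i < N) g (- i.+1%:Z).
    by rewrite big_mkord.
  rewrite (big_cat_nat (n := P))//= [X in _ + X]big_nat_cond [X in _ + X]big1.
    rewrite addr0 big_mkord (reindex_inj rev_ord_inj) /=.
    apply: eq_bigr => i _; congr g.
    have -> : (P - i.+1).+1 = (P - i)%N by rewrite subnSK.
    by rewrite -subzn ?opprB// ltnW.
  move=> i; rewrite andbT => /andP[Pi _]; apply: g0.
  by rewrite ltrN2 ltz_nat ltnS.
apply: eq_bigr => i _; congr g.
by rewrite PoszD addrAC subrr add0r.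
Qed.

(** Makes a two-sided sum with finitely many negative terms an ordinary series: the symmetric
    partial sums are its partial sums shifted by P. *)
Lemma has_zsumP g (P : nat) (l : R[i]) :
  (forall n : int, n < - P%:Z -> g n = 0) ->
  has_zsum g l <->
  \sum_(i < K) g (i%:Z - P%:Z) @[K --> \oo] --> (l : R[i]^o).
Proof.
move=> g0.
have e : \forall N \near \oo,
    zpartial g N = \sum_(i < N + P) g (i%:Z - P%:Z).
  by exists P => // N /= PN; exact: zpartialE.
have shift := @cvg_shiftn P R[i]^o (fun K => \sum_(i < K) g (i%:Z - P%:Z))
  (nbhs (l : R[i]^o)).
rewrite /has_zsum; split=> h.
  rewrite -shift; apply: cvg_trans h; apply: near_eq_cvg.
  by apply: filterS e => N ->.
rewrite -shift in h; apply: cvg_trans h; apply: near_eq_cvg.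
by apply: filterS e => N ->.
Qed.

End IntegerSums.

Section SumBounds.
Variable R : realType.
Implicit Types (x q M : R).

Lemma cvg_normc_le (x : nat -> R[i]) (l z : R[i]) M (N : nat) :
  x n @[n --> \oo] --> (l : R[i]^o) ->
  (forall n, (N <= n)%N -> normc (x n - z) <= M) -> normc (l - z) <= M.
Proof.
move=> /cvg_complexP xl xM; apply/ler_addgt0Pr => e e0.
move/cvgrPdist_lt : xl => /(_ e e0) [N' _ H].
have := H (maxn N N'); rewrite /= leq_maxr => /(_ isT).
rewrite sub0r normrN ger0_norm ?normc_ge0// => h.
have -> : l - z = (x (maxn N N') - z) - (x (maxn N N') - l) by ring.
rewrite (le_trans (le_normcD _ _))// normcN lerD//; last exact: ltW.
by rewrite xM// leq_maxl.
Qed.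

Lemma geometric_sum_le (B0 q : R) (m n : nat) : 0 <= B0 -> 0 <= q < 1 ->
  \sum_(m <= i < n) B0 * q ^+ i <= B0 * q ^+ m / (1 - q).
Proof.
move=> b0 /andP[q0 q1]; have q10 : 0 < 1 - q by rewrite subr_gt0.
have [nm|mn] := leqP n m.
  by rewrite big_geq// divr_ge0 ?mulr_ge0 ?exprn_ge0// ltW.
rewrite ler_pdivlMr// -mulr_sumr -mulrA ler_wpM2l//.
rewrite -{1}(add0n m) big_addn mulr_suml.
have -> : \sum_(0 <= i < n - m) q ^+ (i + m) * (1 - q) = q ^+ m * (1 - q ^+ (n
  - m)).
  elim: (n - m)%N => [|k ih]; first by rewrite big_nil expr0 subrr mulr0.
  rewrite big_nat_recr //= ih exprD exprS; ring.
by rewrite ler_piMr ?exprn_ge0// gerBl exprn_ge0.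
Qed.

Lemma cexp_2pii : cexp ((2 * pi)%:C * 'i) = 1 :> R[i].
Proof.
have h : 2 * pi = pi *+ 2 :> R by rewrite mulr_natl.
by rewrite /cexp cReM cImM /= !(mul0r, mulr0, mulr1, subr0, addr0)
  expR0 h cos2pi
  sin2pi mulr1 mulr0.
Qed.

Lemma cexp_natZ (n : nat) (x : R) :
  cexp ((n%:R * x)%:C * 'i) = cexp (x%:C * 'i) ^+ n.
Proof. by rewrite rmorphM rmorph_nat -mulrA cexp_nat. Qed.

(** By 1 - cos x = 2 sin^2 (x / 2), where |x| / 2 lies strictly between 0 and pi. *)
Lemma cos_neq1 x : x != 0 -> `|x| < 2 * pi -> cos x != 1 :> R.
Proof.
move=> x0 x2; rewrite -cos_norm; apply/eqP => h.
pose y := `|x| / 2.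
have : 0 < sin y.
  rewrite sin_gt0_pi// /y divr_gt0 ?normr_gt0//= ltr_pdivrMr// mulrC//.
have hy : `|x| = y *+ 2 by rewrite /y -mulr_natr divfK.
move: h; rewrite hy cos_mulr2n cos2sin2 => h.
have : sin y ^+ 2 = 0.
  lra.
by move=> /eqP; rewrite sqrf_eq0 => /eqP ->; rewrite ltxx.
Qed.

(** A geometric sum over the powers of e^(2 pi i (i - j) / K), a K-th root of unity different from 1
    because 0 < |i - j| < K. *)
Lemma sum_unity_root (K i j : nat) : (i < K)%N -> (j < K)%N -> i != j ->
  \sum_(l < K) cexp ((2 * pi * (i%:R - j%:R) * (l%:R / K%:R))%:C * 'i) = 0 :>
    R[i].
Proof.
move=> iK jK ij; have K0 : K%:R != 0 :> R by rewrite pnatr_eq0 -lt0n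
  (leq_ltn_trans _ iK).
pose x : R := 2 * pi * (i%:R - j%:R) / K%:R.
pose w : R[i] := cexp (x%:C * 'i).
have -> : \sum_(l < K) cexp ((2 * pi * (i%:R - j%:R) * (l%:R / K%:R))%:C * 'i) =
    \sum_(l < K) w ^+ l.
  apply: eq_bigr => l _; rewrite /w -cexp_natZ.
  have -> // : 2 * pi * (i%:R - j%:R) * (l%:R / K%:R) = l%:R * x.
  by rewrite /x; ring.
have w1 : w != 1.
  apply/eqP => /(congr1 (@complex.Re R)); rewrite /w /cexp cReM cImM /=.
  rewrite !(mul0r, mulr0, mulr1, subr0, addr0) expR0 mul1r.
  apply/eqP/cos_neq1.
    rewrite /x mulf_eq0 invr_eq0 (negbTE K0) orbF mulf_eq0 mulf_eq0 pnatr_eq0/=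
      gt_eqF ?pi_gt0//= subr_eq0.
    by rewrite eqr_nat.
  have Kp : 0 < K%:R :> R by rewrite ltr0n (leq_ltn_trans _ iK).
  have tp0 : 0 < 2 * pi :> R by rewrite mulr_gt0// pi_gt0.
  rewrite /x -[_ / _]mulrA normrM (gtr0_norm tp0) gtr_pMr//.
  rewrite normrM normfV (gtr0_norm Kp) ltr_pdivrMr// mul1r ltr_norml.
  have [iK' jK'] : i%:R < K%:R :> R /\ j%:R < K%:R :> R by rewrite !ltr_nat.
  have i0 : 0 <= i%:R :> R by []. have j0 : 0 <= j%:R :> R by [].
  apply/andP; split; lra.
have wK : w ^+ K = 1.
  rewrite /w -cexp_natZ.
  have -> : K%:R * x = i%:R * (2 * pi) - j%:R * (2 * pi) by rewrite /x; field.
  rewrite rmorphB mulrBl cexpD cexpN (cexp_natZ i) (cexp_natZ j) cexp_2pii.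
  by rewrite !expr1n invr1 mulr1.
have := subrX1 w K; rewrite wK subrr => /esym/eqP; rewrite mulf_eq0 subr_eq0.
by rewrite (negbTE w1) => /eqP.
Qed.

End SumBounds.

Section FourierTerms.
Variables (R : realType) (a : int -> R[i]) (kap : R) (P : nat).

(* A series supported on n >= - P is indexed by i = n + P. *)
Definition fourier_freq (i : nat) : R := (i%:Z - P%:Z)%:~R + kap.

Definition fourier_term (i : nat) (tau : R[i]) : R[i] :=
  a (i%:Z - P%:Z) * cexp ((2 * pi * fourier_freq i)%:C * ('i * tau)).

Definition fourier_abs (i : nat) (v : R) : R :=
  normc (a (i%:Z - P%:Z)) * expR (- (2 * pi * fourier_freq i * v)).

Lemma fourier_abs_ge0 i v : 0 <= fourier_abs i v.
Proof. by rewrite mulr_ge0 ?normc_ge0 ?expR_ge0. Qed.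

Lemma normc_fourier_term i tau :
  normc (fourier_term i tau) = fourier_abs i (Im tau).
Proof.
rewrite /fourier_term ComplexField.Normc.normcM normc_cexp !cReM !cImM /=.
by congr (_ * expR _); ring.
Qed.

End FourierTerms.

(** * Bounds for the terms of a Fourier expansion *)

Section FourierExpansion.
Variables (R : realType) (a : int -> R[i]) (kap : R) (F : R[i] -> R[i]).
Variable P : nat.
Hypothesis kap01 : 0 <= kap < 1.
Hypothesis a_eq0 : forall n : int, n < - P%:Z -> a n = 0.
Hypothesis hF : forall tau, upper_half tau ->
  has_zsum (fun n : int =>
    a n * cexp (2 * pi%:C * 'i * (n%:~R + kap%:C) * tau)) (F tau).
Implicit Types (u v t M c : R).

Local Notation nu := (fourier_freq kap P).
Local Notation tm := (fourier_term a kap P).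
Local Notation B := (fourier_abs a kap P).
Local Notation normc_tm := (normc_fourier_term a kap P).

Let B_ge0 i v : 0 <= B i v. Proof. exact: fourier_abs_ge0. Qed.

Let pi0 : 0 < pi :> R. Proof. exact: pi_gt0. Qed.
Let tpi0 : 0 < 2 * pi :> R. Proof. by rewrite mulr_gt0. Qed.

Let nuE i : nu i = i%:R - P%:R + kap.
Proof. by rewrite /fourier_freq intrB. Qed.

Lemma fourier_term_cvg tau : upper_half tau ->
  \sum_(i < K) tm i tau @[K --> \oo] --> (F tau : R[i]^o).
Proof.
move=> tH.
have /has_zsumP := hF tH; move=> /(_ P) h.
have {h} : \sum_(i < K) a (i%:Z - P%:Z) *
  cexp (2 * pi%:C * 'i * ((i%:Z - P%:Z)%:~R + kap%:C) * tau) @[K --> \oo]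
    --> (F tau : R[i]^o).
  by apply: h => n nP; rewrite a_eq0// mul0r.
set S := (X in X @ _ --> _ -> _);
  have -> // : S = (fun K => \sum_(i < K) tm i tau).
apply/funext => K; apply: eq_bigr => i _.
rewrite /fourier_term; congr (_ * cexp _).
rewrite -[_%:~R](rmorph_int (real_complex R)) -rmorphD -/(nu i).
have -> : (2 * pi * nu i)%:C = 2 * pi%:C * (nu i)%:C by rewrite !rmorphM
  rmorph_nat.
ring.
Qed.

(** Convergence at height v / 2 bounds the terms there; raising the height to v multiplies the i-th
    one by e^(- pi nu_i v), with nu_i >= i - P. *)
Let geometric v : 0 < v -> exists B0 q : R,
  [/\ 0 <= B0, 0 <= q < 1 & forall i, B i v <= B0 * q ^+ i].
Proof.
move=> v0; have v20 : 0 < v / 2 by rewrite divr_gt0.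
have tH : upper_half (0 +i* (v / 2)) by [].
have /cvg_complexP/cvgrPdist_lt/(_ 1 ltr01) [N _ HN] := fourier_term_cvg tH.
(* From N on, a term is the difference of two partial sums within 1 of the limit, hence at most 2;
   the finite sum covers the earlier terms. *)
pose D := 2 + \sum_(i < N) B i (v / 2).
have D0 : 0 <= D by rewrite addr_ge0// sumr_ge0.
have BD i : B i (v / 2) <= D.
  have [Ni|iN] := leqP N i.
    have h1 := HN i Ni; have h2 := HN i.+1 (leqW Ni); move: h1 h2 => /=.
    rewrite !sub0r !normrN ![`|normc _|]ger0_norm ?normc_ge0// => h1 h2.
    rewrite -[v / 2]/(Im (0 +i* (v / 2))) -normc_tm.
    have -> : tm i (0 +i* (v / 2)) = (\sum_(j < i.+1) tm j (0 +i* (v / 2)) - F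
      (0 +i* (v / 2)))
       - (\sum_(j < i) tm j (0 +i* (v / 2)) - F (0 +i* (v / 2))).
      by rewrite big_ord_recr /=; ring.
    rewrite (le_trans (le_normcD _ _))// normcN.
    rewrite (@le_trans _ _ 2)//; last by rewrite lerDl sumr_ge0.
    by rewrite -[2]/(1 + 1) lerD// ltW.
  rewrite /D (bigD1 (Ordinal iN))//= addrCA lerDl addr_ge0// sumr_ge0//.
exists (D * expR (2 * pi * P%:R * (v / 2))), (expR (- (2 * pi * (v / 2))));
  split.
- by rewrite mulr_ge0 ?expR_ge0.
- by rewrite expR_ge0 expR_lt1 oppr_lt0 mulr_gt0.
- move=> i.
  have -> : B i v = B i (v / 2) * expR (- (2 * pi * nu i * (v / 2))).
    by rewrite /fourier_abs -[RHS]mulrA -expRD; congr (_ * expR _); field.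
  rewrite -[X in _ <= X]mulrA ler_pM ?expR_ge0// -expRM_natl -expRD ler_expR
    nuE.
  have kap0 : 0 <= kap by case/andP: kap01.
  have h1 : 0 <= 2 * pi * kap * (v / 2).
    by rewrite mulr_ge0 ?(ltW v20)// mulr_ge0 ?(ltW tpi0).
  rewrite -subr_ge0; apply: le_trans h1 _; rewrite le_eqVlt; apply/orP; left.
  by apply/eqP; ring.
Qed.

Let tail v u B0 q K : 0 < v -> 0 <= B0 -> 0 <= q < 1 ->
  (forall i, B i v <= B0 * q ^+ i) ->
  normc (F (u +i* v) - \sum_(i < K) tm i (u +i* v)) <= B0 * q ^+ K / (1 - q).
Proof.
move=> v0 b0 q01 HB; have tH : upper_half (u +i* v) by [].
apply: (cvg_normc_le (N := K) (fourier_term_cvg tH)) => n Kn.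
rewrite -(big_mkord xpredT (tm^~ (u +i* v))) -(big_mkord xpredT (tm^~ (u +i*
  v))).
rewrite (big_cat_nat (n := K))//= addrAC subrr add0r.
rewrite (le_trans (normc_sum _ _ _))//.
rewrite (le_trans _ (geometric_sum_le K n b0 q01))//.
by apply: ler_sum => i _; rewrite normc_tm /=.
Qed.

(* Averaging the K-th partial sum over the points l / K + i v isolates each of
   its terms, which replaces the integral formula for the coefficients. *)
Let coef_partial v (K i : nat) : (i < K)%N ->
  K%:R * tm i (0 +i* v) =
  \sum_(l < K) (\sum_(j < K) tm j ((l%:R / K%:R) +i* v)) *
     cexp (- ((2 * pi * nu i * (l%:R / K%:R))%:C * 'i)).
Proof.
move=> iK.
(* The shift [kap] cancels in nu_j - nu_i, so that only integer frequencies remain. *)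
have e (l j : 'I_K) : tm j ((l%:R / K%:R) +i* v) *
    cexp (- ((2 * pi * nu i * (l%:R / K%:R))%:C * 'i)) =
    tm j (0 +i* v) * cexp ((2 * pi * (j%:R - i%:R) * (l%:R / K%:R))%:C * 'i).
  rewrite /fourier_term -!mulrA -!cexpD; congr (_ * cexp _).
  by apply: complex_eq; rewrite ?cReD ?cImD ?cReN ?cImN ?cReM ?cImM /= !nuE;
    ring.
under eq_bigr => l _ do (rewrite mulr_suml; under eq_bigr => j _ do rewrite e).
rewrite exchange_big /= (bigD1 (Ordinal iK))//= [X in _ + X]big1 ?addr0.
  rewrite -mulr_sumr mulrC; congr (_ * _).
  under eq_bigr do rewrite subrr mulr0 mul0r mul0r cexp0.
  by rewrite sumr_const card_ord.
move=> j ji; rewrite -mulr_sumr sum_unity_root ?mulr0//.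
Qed.

(** A discrete Cauchy estimate: by [coef_partial] the term is an average of K values of the K-th
    partial sum, each within M plus a tail that is uniform in u and tends to 0 with K. *)
Let coef_le v M i : 0 < v -> (forall u, normc (F (u +i* v)) <= M) -> B i v <= M.
Proof.
move=> v0 FM; have [B0 [q [b0 q01 HB]]] := geometric v0.
have q1 : 0 < 1 - q by rewrite subr_gt0; case/andP : q01.
apply/ler_addgt0Pr => e e0.
have : B0 / (1 - q) * q ^+ K @[K --> \oo] --> B0 / (1 - q) * 0.
  by apply: cvgMr; apply: cvg_expr; rewrite ger0_norm; case/andP : q01.
rewrite mulr0 => /cvgrPdist_lt/(_ e e0)[N _ HN].
pose K := maxn N i.+1.
have iK : (i < K)%N by rewrite leq_maxr.
have := HN K; rewrite /= leq_maxl => /(_ isT) hK.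
have K0 : 0 < K%:R :> R by rewrite ltr0n (leq_ltn_trans _ iK).
rewrite -(ler_pM2l K0).
have -> : K%:R * B i v = normc (K%:R * tm i (0 +i* v)).
  rewrite ComplexField.Normc.normcM normc_tm /=.
  by rewrite -(rmorph_nat (real_complex R)) normc_real ger0_norm ?ltW.
rewrite (coef_partial v iK) (le_trans (normc_sum _ _ _))//.
have -> : K%:R * (M + e) = \sum_(l < K) (M + e).
  by rewrite sumr_const card_ord mulr_natl.
apply: ler_sum => l _.
rewrite ComplexField.Normc.normcM normc_cexp cReN cReM /=.
rewrite mulr0 mul0r subr0 oppr0 expR0 mulr1.
set z := (_ +i* v).
have -> : \sum_(j < K) tm j z = F z - (F z - \sum_(j < K) tm j z) by ring.
rewrite (le_trans (le_normcD _ _))// normcN lerD ?FM//.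
apply: (le_trans (tail _ K v0 b0 q01 HB)).
move: hK; rewrite sub0r normrN => /ltW; apply: le_trans.
by rewrite mulrAC ler_norm.
Qed.

(** By [coef_le], |a| e^(- 2 pi nu v) stays below M e^(2 pi n0 v) for large v; if nu < - n0 the left
    side grows faster, unless the coefficient is 0. *)
Let vanish (n0 : nat) i :
  (exists M V : R, forall tau, upper_half tau -> V <= Im tau ->
     normc (F tau) <= M * expR (2 * pi * n0%:R * Im tau)) ->
  nu i < - n0%:R -> a (i%:Z - P%:Z) = 0.
Proof.
move=> [M [V HM]] nui; apply/eqP/negP => /negP a0.
have A0 : 0 < normc (a (i%:Z - P%:Z)).
  rewrite lt_neqAle normc_ge0 andbT eq_sym.
  by apply: contra a0 => /eqP/ComplexField.Normc.eq0_normc ->.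
set A := normc _ in A0.
pose d := 2 * pi * (- n0%:R - nu i).
have d0 : 0 < d by rewrite mulr_gt0// subr_gt0.
(* High enough for the growth bound to apply, and for A e^(d v) > A d v >= |M| + 1 to contradict
   it. *)
pose v := Num.max V (Num.max 1 ((`|M| + 1) / (A * d))).
have vV : V <= v by rewrite le_max lexx.
have v1 : 1 <= v by rewrite !le_max lexx /= orbT.
have vM : (`|M| + 1) / (A * d) <= v by rewrite !le_max lexx /= !orbT.
have v0 : 0 < v by exact: lt_le_trans v1.
have := @coef_le v (M * expR (2 * pi * n0%:R * v)) i v0 (fun u => HM (u +i* v)
  v0 vV).
rewrite /fourier_abs -/A => h.
have : A * expR (d * v) <= M.
  rewrite -(ler_pM2r (expR_gt0 (2 * pi * n0%:R * v))).
  apply: le_trans h; rewrite -[X in X <= _]mulrA -expRD le_eqVlt; apply/orP;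
    left; apply/eqP.
  by congr (_ * expR _); rewrite /d; ring.
apply/negP; rewrite -ltNge (le_lt_trans (ler_norm M))//.
rewrite (@lt_le_trans _ _ (A * (d * v)))//.
  move: vM; rewrite ler_pdivrMr ?(mulr_gt0 A0 d0)// => vM.
  by rewrite mulrA mulrC (lt_le_trans _ vM)// ltrDl.
rewrite ler_pM2l// (le_trans _ (expR_ge1Dx _))// lerDr//.
Qed.

Let bound_at v0 : 0 < v0 -> exists2 A, 0 <= A &
  forall K, \sum_(i < K) B i v0 <= A.
Proof.
move=> v00; have [B0 [q [b0 q01 HB]]] := geometric v00.
have q1 : 0 < 1 - q by rewrite subr_gt0; case/andP : q01.
exists (B0 / (1 - q)); first by rewrite divr_ge0// ltW.
move=> K; have := geometric_sum_le 0 K b0 q01; rewrite expr0 mulr1.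
apply: le_trans; rewrite big_mkord; apply: ler_sum => i _; exact: HB.
Qed.

Lemma normc_fourier_le tau A : upper_half tau ->
  (forall K, \sum_(i < K) B i (Im tau) <= A) -> normc (F tau) <= A.
Proof.
move=> tH HA; rewrite -[F tau]subr0.
apply: (cvg_normc_le (N := 0%N) (fourier_term_cvg tH)) => K _; rewrite subr0.
rewrite (le_trans (normc_sum _ _ _))// (le_trans _ (HA K))//.
by apply: ler_sum => i _; rewrite normc_tm.
Qed.

Section Growth.
Variable n0 : nat.
Hypothesis growth : exists M V : R, forall tau, upper_half tau ->
  V <= Im tau -> normc (F tau) <= M * expR (2 * pi * n0%:R * Im tau).

(** The ratio of the two terms is e^(- 2 pi nu (v - v0)), and the surviving frequencies satisfy nu
    >= - n0. *)
Let B_mono v0 v i : v0 <= v ->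
  B i v <= B i v0 * expR (2 * pi * n0%:R * (v - v0)).
Proof.
move=> vv; have [nui|nui] := ltP (nu i) (- n0%:R).
  by rewrite /fourier_abs (vanish growth nui) ComplexField.Normc.normc0 !mul0r.
rewrite /fourier_abs -[X in _ <= X]mulrA ler_wpM2l ?normc_ge0// -expRD ler_expR.
have : 0 <= 2 * pi * ((nu i + n0%:R) * (v - v0)).
  by rewrite mulr_ge0 ?(ltW tpi0)// mulr_ge0// ?subr_ge0// -lerBlDr sub0r.
move=> h; rewrite -subr_ge0; apply: le_trans h _.
by rewrite le_eqVlt; apply/orP; left; apply/eqP; ring.
Qed.

(** Any threshold v0 > 0 is allowed, although the growth hypothesis only speaks of heights above an
    unspecified V. The thresholds used later are 1 / 5 and 1. *)
Lemma fourier_sum_le_high v0 : 0 < v0 -> exists2 A, 0 <= A &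
  forall v K, v0 <= v ->
    \sum_(i < K) B i v <= A * expR (2 * pi * n0%:R * v).
Proof.
move=> v00; have [A A0 HA] := bound_at v00; exists A => // v K vv.
apply: (@le_trans _ _ (\sum_(i < K) B i v0 * expR (2 * pi * n0%:R * v))).
  apply: ler_sum => i _; rewrite (le_trans (B_mono _ vv))// ler_wpM2l//.
  by rewrite ler_expR ler_wpM2l ?gerBl ?(ltW v00)// mulr_ge0 ?(ltW tpi0).
by rewrite -mulr_suml ler_wpM2r ?expR_ge0.
Qed.

Lemma fourier_norm_le_high v0 : 0 < v0 -> exists2 A, 0 <= A &
  forall tau, v0 <= Im tau -> normc (F tau) <= A * expR (2 * pi * n0%:R * Im
    tau).
Proof.
move=> v00; have [A A0 HA] := fourier_sum_le_high v00; exists A => // tau vt.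
have tH : upper_half tau by exact: lt_le_trans vt.
apply: normc_fourier_le => // K; exact: HA.
Qed.

End Growth.

(** Each term is estimated at the lower height th v, and the descent from v to th v leaves a
    geometric factor q^i that makes the bounds summable. The sum costs 1 / (1 - q), of order 1 / v,
    which the gap between c and c1 absorbs. *)
Lemma fourier_sum_le_low C c c1 : 0 < c -> c < c1 ->
  (forall u v, 0 < v <= 1 -> normc (F (u +i* v)) <= C * expR (2 * pi * c / v))
    ->
  exists C', forall v K, 0 < v <= 1 ->
    \sum_(i < K) B i v <= C' * expR (2 * pi * c1 / v).
Proof.
move=> c0 cc1 HC.
(* With this choice c / th = (c + c1) / 2, so exactly [eta] remains of c1 to absorb 1 / (1 - q). *)
pose th := 2 * c / (c + c1).
have c10 : 0 < c1 by exact: lt_trans cc1.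
have s0 : 0 < c + c1 by rewrite addr_gt0.
have th0 : 0 < th by rewrite divr_gt0// mulr_gt0.
have th1 : th < 1 by rewrite ltr_pdivrMr// mul1r; lra.
have oth : 0 < 1 - th by rewrite subr_gt0.
pose eta := (c1 - c) / 2.
have eta0 : 0 < eta by rewrite divr_gt0// subr_gt0.
have C0 : 0 <= C.
  have := HC 0 1; rewrite ltr01 lexx => /(_ isT) h.
  by have := le_trans (normc_ge0 _) h; rewrite pmulr_lge0// expR_gt0.
(* Collects 1 / (1 - q) <= 1 + 1 / (2 pi (1 - th) v) and 1 / v <= e^(2 pi eta / v) / (2 pi eta). *)
pose G := 1 + (2 * pi * (1 - th) * (2 * pi * eta))^-1.
have t1 : 0 < 2 * pi * (1 - th) by rewrite mulr_gt0.
have t2 : 0 < 2 * pi * eta by rewrite mulr_gt0.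
have G0 : 0 <= G by rewrite addr_ge0// invr_ge0 ltW// mulr_gt0.
exists (C * expR (2 * pi * P%:R) * G) => v K /andP[v0 v1].
pose q := expR (- (2 * pi * (1 - th) * v)).
have x0 : 0 < 2 * pi * (1 - th) * v by rewrite mulr_gt0.
have q01 : 0 <= q < 1 by rewrite expR_ge0 expR_lt1 oppr_lt0.
have q1 : 0 < 1 - q by rewrite subr_gt0; case/andP : q01.
pose B0 := C * expR (2 * pi * c / (th * v)) * expR (2 * pi * P%:R).
have b0 : 0 <= B0 by rewrite !mulr_ge0 ?expR_ge0.
have thv : 0 < th * v <= 1.
  by rewrite mulr_gt0//= (le_trans _ v1)// ler_piMl ?ltW.
have HB i : B i v <= B0 * q ^+ i.
  have -> : B i v = B i (th * v) * expR (- (2 * pi * nu i * ((1 - th) * v))).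
    by rewrite /fourier_abs -[RHS]mulrA -expRD; congr (_ * expR _); ring.
  rewrite /B0 -[X in _ <= X]mulrA ler_pM ?expR_ge0//.
    by apply: coef_le; [case/andP : thv|move=> u; exact: HC].
  rewrite /q -expRM_natl -expRD ler_expR nuE.
  have kap0 : 0 <= kap by case/andP: kap01.
  have h1 : 0 <= 2 * pi * (kap * ((1 - th) * v)).
    by rewrite mulr_ge0 ?(ltW tpi0)// mulr_ge0// mulr_ge0 ?(ltW oth) ?(ltW v0).
  have h2 : 0 <= 2 * pi * (P%:R * (1 - (1 - th) * v)).
    rewrite !mulr_ge0 ?(ltW pi0)// subr_ge0 (le_trans _ v1)// ler_piMl ?ltW//.
    by rewrite gtrBl.
  rewrite -subr_ge0; apply: le_trans (addr_ge0 h1 h2) _.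
  by rewrite le_eqVlt; apply/orP; left; apply/eqP; ring.
apply: (@le_trans _ _ (B0 / (1 - q))).
  have := geometric_sum_le 0 K b0 q01; rewrite expr0 mulr1.
  apply: le_trans; rewrite big_mkord; apply: ler_sum => i _; exact: HB.
have qle : (1 - q)^-1 <= G * expR (2 * pi * eta / v).
  have e1 : 1 <= expR (2 * pi * eta / v).
    by rewrite -[X in X <= _]expR0 ler_expR divr_ge0 ?(ltW t2) ?(ltW v0).
  have e2 : v^-1 <= (2 * pi * eta)^-1 * expR (2 * pi * eta / v).
    rewrite -ler_pdivrMl ?invr_gt0// invrK mulrC.
    by rewrite (le_trans _ (expR_ge1Dx _))// mulrC lerDr.
  apply: (@le_trans _ _ (1 + (2 * pi * (1 - th) * v)^-1)).
    set x := 2 * pi * (1 - th) * v in x0 *.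
    have -> : 1 + x^-1 = (1 + x) / x.
      by rewrite mulrDl mul1r divff ?gt_eqF// addrC.
    have x10 : 0 < 1 + x by rewrite addr_gt0.
    rewrite -invf_div lef_pV2 ?posrE ?divr_gt0//.
    rewrite ler_pdivrMr// mulrBl mul1r lerBrDr.
    have : q * (1 + x) <= 1.
      rewrite /q -/x expRN mulrC ler_pdivrMr ?expR_gt0// mul1r;
        exact: expR_ge1Dx.
    lra.
  rewrite /G [X in _ <= X]mulrDl [X in _ <= X + _]mul1r lerD// (invfM _ v).
  rewrite (invfM (2 * pi * (1 - th)) (2 * pi * eta)) -[X in _ <= X]mulrA.
  by rewrite ler_pM2l ?invr_gt0.
rewrite (le_trans (ler_wpM2l b0 qle))// /B0.
have -> : expR (2 * pi * c1 / v) = expR (2 * pi * c / (th * v)) * expR (2 * pi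
  * eta / v).
  rewrite -expRD; congr expR; rewrite /th /eta; field.
  by rewrite !gt_eqF.
by rewrite le_eqVlt; apply/orP; left; apply/eqP; ring.
Qed.

End FourierExpansion.

(** * Growth of modular forms near the real line *)

Section DirichletApproximation.
Variable R : realType.

(** The pigeonhole principle puts two of the N + 1 fractional parts of 0, u, ..., N u into one of N
    boxes of length 1 / N. The pair found need not be coprime. *)
Lemma dirichlet_approximation (u : R) (N : nat) : (0 < N)%N ->
  exists c d : int, [/\ 0 < c, c <= N%:Z & `|c%:~R * u + d%:~R| <= N%:R^-1].
Proof.
case: N => // N _.
pose fr (i : nat) : R := i%:R * u - (Num.floor (i%:R * u))%:~R.
have fr01 i : 0 <= fr i < 1.
  have /andP[h1 h2] := floor_itv (i%:R * u).
  by rewrite /fr subr_ge0 h1 /= ltrBlDl -intrD1.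
have N0 : 0 < N.+1%:R :> R by [].
pose box (i : 'I_N.+2) : 'I_N.+1 := inord (Num.truncn (N.+1%:R * fr i)).
have boxE (i : 'I_N.+2) : ((box i : nat)%:R : R) <= N.+1%:R * fr i < (box
  i).+1%:R.
  have /andP[f0 f1] := fr01 i.
  have y0 : 0 <= N.+1%:R * fr i by rewrite mulr_ge0.
  rewrite /box inordK; first exact: truncn_itv.
  by rewrite truncn_lt_nat// gtr_pMr.
have ninj : ~~ injectiveb box.
  apply/negP => /injectiveP/leq_card; rewrite !card_ord.
  by rewrite ltnn.
have [i [j [ij bij]]] : exists i j : 'I_N.+2, (i < j)%N /\ box i = box j.
  have /injectivePn[i [j ij e]] := ninj.
  have : (i != j :> nat) by [].
  rewrite neq_ltn => /orP[h|h]; first by exists i, j.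
  by exists j, i; split.
exists (j - i)%N%:Z, (Num.floor (i%:R * u) - Num.floor (j%:R * u)); split.
- by rewrite ltz_nat subn_gt0.
- by rewrite lez_nat (leq_trans (leq_subr _ _))// -ltnS.
- have -> : (j - i)%N%:Z%:~R * u + (Num.floor (i%:R * u) - Num.floor (j%:R *
  u))%:~R
      = fr j - fr i.
    by rewrite /fr -pmulrn natrB ?(ltnW ij)// intrB; ring.
  rewrite -(ler_pM2l N0) divff ?gt_eqF// -[X in X * _]ger0_norm// -normrM
    mulrBr.
  have /andP[a1 a2] := boxE i; have /andP[b1 b2] := boxE j.
  rewrite bij in a1 a2; move: a2 b2; rewrite -natr1 => a2 b2.
  by rewrite ler_norml; apply/andP; split; lra.
Qed.

End DirichletApproximation.

(** * Moving a point away from the real line *)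

Section ModularReduction.
Variable R : realType.
Implicit Types (u v : R) (tau z w : R[i]).

Lemma Im_div z w : Im (z / w) = (Im z * Re w - Re z * Im w) / normc w ^+ 2.
Proof.
rewrite sqr_normc_ReIm; case: z => a b; case: w => c d.
by rewrite cImM /=; ring.
Qed.

Definition mx22 (T : Type) (a b c d : T) : 'M[T]_2 :=
  \matrix_(i < 2, j < 2) if i == 0 then (if j == 0 then a else b)
                         else (if j == 0 then c else d).

Lemma det_mx22 (a b c d : int) : \det (mx22 a b c d) = a * d - b * c.
Proof.
rewrite (expand_det_row _ 0) !big_ord_recl big_ord0 /cofactor !det_mx11 !mxE /=.
by rewrite !expr0 /= !mul1r; ring.
Qed.

Lemma Im_moebius g tau : SL2Z g ->
  Im (moebius g tau) = Im tau / normc (autj g tau) ^+ 2.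
Proof.
rewrite /SL2Z /= => dg; rewrite /moebius Im_div; congr (_ / _).
have e (n : int) : n%:~R = (n%:~R : R)%:C :> R[i] by rewrite rmorph_int.
have d1 : (g 0 0)%:~R * (g 1 1)%:~R - (g 0 1)%:~R * (g 1 0)%:~R = 1 :> R.
  rewrite -!intrM -intrB -[RHS]/(1%:~R) -dg (expand_det_row _ 0).
  rewrite !big_ord_recl big_ord0 /cofactor !det_mx11 !mxE /=.
  have -> : lift 0 0 = 1 :> 'I_2 by apply/val_inj.
  have -> : lift 1 0 = 0 :> 'I_2 by apply/val_inj.
  by congr (_%:~R); rewrite expr0 /=; ring.
rewrite /autj !e !cReD !cImD !cReM !cImM /=.
transitivity (((g 0 0)%:~R * (g 1 1)%:~R - (g 0 1)%:~R * (g 1 0)%:~R) * Im tau).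
  by ring.
by rewrite d1 mul1r.
Qed.

(* Dirichlet's theorem with denominators up to about v^(-1/2) plays the role of
   the reduction to a fundamental domain. *)
Lemma modular_reduction u v : 0 < v <= 1 ->
  exists g : 'M[int]_2, [/\ SL2Z g, v <= normc (autj g (u +i* v)) &
    normc (autj g (u +i* v)) ^+ 2 <= 5 * v].
Proof.
move=> /andP[v0 v1]; pose r := Num.sqrt v.
have r0 : 0 < r by rewrite sqrtr_gt0.
have r2 : r ^+ 2 = v by rewrite sqr_sqrtr// ltW.
have r1 : r <= 1 by rewrite -ler_sqr ?nnegrE ?(ltW r0)// r2 expr1n.
(* Just above 1 / r with r = v^(1/2): this gives 1 / N <= r and also N v <= (1 / r + 1) v <= 2 r. *)
pose N := (Num.truncn r^-1).+1.
have /andP[N1 N2] : (Num.truncn r^-1)%:R <= r^-1 < N%:R.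
  by apply: truncn_itv; rewrite invr_ge0 ltW.
have [c [d [c0 cN cd]]] := dirichlet_approximation u (ltn0Sn _ : (0 < N)%N).
have NrB : N%:R^-1 <= r by rewrite invf_ple ?posrE ?ltW.
have cv : c%:~R * v <= 2 * r.
  have cN' : c%:~R <= N%:R :> R by rewrite -[N%:R]/(N%:Z%:~R) ler_int.
  apply: (@le_trans _ _ (N%:R * v)); first by rewrite ler_pM2r.
  have : N%:R <= r^-1 + 1 by rewrite /N -natr1 lerD2r.
  rewrite -(ler_pM2r v0) => /le_trans; apply.
  rewrite -r2 mulrDl mul1r expr2 mulrA mulVf ?gt_eqF// mul1r.
  have : r * r <= r by rewrite ler_piMl// ltW.
  lra.
have cR0 : 0 < c%:~R :> R by rewrite ltr0z.
have c5 : (c%:~R * u + d%:~R) ^+ 2 + (c%:~R * v) ^+ 2 <= 5 * v.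
  have h1 : (c%:~R * u + d%:~R) ^+ 2 <= v.
    rewrite -r2 -[X in X <= _]real_normK ?num_real// ler_sqr ?nnegrE ?(ltW
      r0)//.
    exact: le_trans NrB.
  have h2 : (c%:~R * v) ^+ 2 <= 4 * v.
    rewrite (_ : 4 * v = (2 * r) ^+ 2); last by rewrite exprMn r2; ring.
    by rewrite ler_sqr ?nnegrE// ?mulr_ge0 ?ltW.
  lra.
(* Dividing c and d by their gcd makes them a bottom row of SL2(Z), with top row from Bezout, and
   can only decrease |c tau + d|. *)
have [x [y xy]] := Bezoutz c d.
set G := gcdz c d in xy.
have G0 : 0 < G by rewrite lt_neqAle eq_sym gcdz_eq0 gt_eqF//= /G /gcdz lez_nat.
have [c' c'E] := dvdzP (dvdz_gcdl c d).
have [d' d'E] := dvdzP (dvdz_gcdr c d).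
rewrite -/G in c'E d'E.
have c'0 : 0 < c' by move: c0; rewrite c'E pmulr_lgt0.
have det1 : x * c' + y * d' = 1.
  have Gn0 : G != 0 by rewrite gt_eqF.
  have := xy; rewrite {1}c'E {1}d'E => h.
  by apply: (mulIf Gn0); rewrite mul1r -[RHS]h; ring.
have GR1 : 1 <= G%:~R :> R by rewrite ler1z -gtz0_ge1.
have gE : autj (mx22 y (- x) c' d') (u +i* v) =
    (c'%:~R * u + d'%:~R) +i* (c'%:~R * v).
  have e (n : int) : n%:~R = (n%:~R : R)%:C :> R[i] by rewrite rmorph_int.
  rewrite /autj !mxE /= !e; apply: complex_eq;
    rewrite ?cReD ?cImD ?cReM ?cImM /=; ring.
exists (mx22 y (- x) c' d'); split.
- by rewrite /SL2Z /= det_mx22 -[RHS]det1; ring.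
- rewrite gE (le_trans _ (normr_Im_le _))//= ger0_norm; last first.
    by rewrite mulr_ge0 ?ler0z ?ltW.
  by rewrite ler_peMl ?(ltW v0)// ler1z -gtz0_ge1.
- rewrite gE sqr_normc_ReIm /=; apply: le_trans c5.
  have -> : c%:~R * u + d%:~R = G%:~R * (c'%:~R * u + d'%:~R).
    by rewrite c'E d'E !intrM; ring.
  have -> : c%:~R * v = G%:~R * (c'%:~R * v) by rewrite c'E intrM; ring.
  have G2 : 1 <= G%:~R ^+ 2 :> R by rewrite exprn_ege1.
  by apply: lerD; rewrite [X in _ <= X]exprMn ler_peMl ?sqr_ge0.
Qed.

(** Row i of U has norm 1, and |U i j|^2 is one of its nonnegative summands. *)
Lemma normc_unitary_le1 (m : nat) (U : 'M[R[i]]_m) (i j : 'I_m) :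
  U \is unitarymx -> normc (U i j) <= 1.
Proof.
move=> /unitarymxP/matrixP/(_ i i); rewrite !mxE eqxx.
move=> /(congr1 (@complex.Re R)); rewrite cRe_sum /= (bigD1 j)//=.
have e k : Re (U i k * (map_mx Num.conj U^T) k i) = normc (U i k) ^+ 2.
  by rewrite !mxE -normCK normr_complexE -rmorphXn.
rewrite e => h; have : normc (U i j) ^+ 2 <= 1.
  rewrite -h lerDl; apply: sumr_ge0 => k _; rewrite e sqr_ge0//.
by rewrite -[X in _ <= X](expr1n _ 2) ler_sqr ?nnegrE ?normc_ge0.
Qed.

End ModularReduction.

Section ModularGrowth.
Variables (R : realType) (m : nat) (k : R).
Variables (chi : 'M[int]_2 -> R[i]) (rho : 'M[int]_2 -> 'M[R[i]]_m).
Variable f : R[i] -> 'cV[R[i]]_m.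
Hypothesis hchi : forall g, SL2Z g -> normc (chi g) = 1.
Hypothesis hrho : forall g, SL2Z g -> rho g \is unitarymx.
Hypothesis hf : forall g tau, SL2Z g -> upper_half tau ->
  slash k chi rho f g tau = f tau.

(** For a real exponent the modulus of [cpow] depends only on the modulus of its base, so the branch
    is irrelevant. The factor m comes from adding m entries of a unitary matrix, each at most 1 in
    modulus. *)
Lemma slash_norm_le g tau (M : R) j : SL2Z g -> upper_half tau ->
  (forall i, normc (f (moebius g tau) i 0) <= M) ->
  normc (f tau j 0) <= expR (- k * ln (normc (autj g tau))) * (m%:R * M).
Proof.
move=> Sg tH HM; rewrite -(hf Sg tH) /slash !mxE !ComplexField.Normc.normcM.
rewrite normc_cpow_real ComplexField.Normc.normcV hchi// invr1 mulr1.
rewrite ler_wpM2l ?expR_ge0// (le_trans (normc_sum _ _ _))//.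
have -> : m%:R * M = \sum_(i < m) M by rewrite sumr_const card_ord mulr_natl.
apply: ler_sum => i _; rewrite ComplexField.Normc.normcM.
rewrite -[X in _ <= X]mul1r ler_pM ?normc_ge0// invmx_unitary ?hrho//.
rewrite !mxE.
have -> : normc (rho g i j)^* = normc (rho g i j).
  by apply: complexI; rewrite -!normr_complexE norm_conjC.
by apply: normc_unitary_le1; exact: hrho.
Qed.

Lemma modular_growth (n0 : nat) (A c : R) : n0%:R < c -> 0 <= A ->
  (forall j tau, 5^-1 <= Im tau ->
     normc (f tau j 0) <= A * expR (2 * pi * n0%:R * Im tau)) ->
  exists C, forall j u v, 0 < v <= 1 ->
    normc (f (u +i* v) j 0) <= C * expR (2 * pi * c / v).
Proof.
move=> n0c A0 HA.
have pi0 : 0 < pi :> R := pi_gt0 R.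
have e0 : 0 < 2 * pi * (c - n0%:R) by rewrite mulr_gt0 ?subr_gt0// mulr_gt0.
(* As v <= w <= 5, one has |ln w| <= ln 5 - ln v, so w^(-k) is at most 5^|k| v^(-|k|) for either
   sign of k; the gap c - n0 absorbs v^(-|k|). *)
have [K HK] := mul_ln_le (- `|k|) e0.
pose e := 2 * pi * (c - n0%:R).
exists (expR (`|k| * ln 5 + (`|K| + e)) * (m%:R * A)) => j u v v01.
have /andP[v0 v1] := v01.
have [g [Sg gv g5]] := modular_reduction u v01.
have tH : upper_half (u +i* v) by [].
set w := normc _ in gv g5.
have w0 : 0 < w by exact: lt_le_trans gv.
have Imge : 5^-1 <= Im (moebius g (u +i* v)).
  rewrite Im_moebius//= ler_pdivlMr ?exprn_gt0// mulrC ler_pdivrMr// mulrC.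
  exact: g5.
have Imle : Im (moebius g (u +i* v)) <= v^-1.
  rewrite Im_moebius//= ler_pdivrMr ?exprn_gt0// mulrC -ler_pdivrMr ?invr_gt0//.
  by rewrite invrK -expr2 ler_sqr ?nnegrE ?(ltW v0) ?(ltW w0).
have HM i : normc (f (moebius g (u +i* v)) i 0) <=
    A * expR (2 * pi * n0%:R / v).
  rewrite (le_trans (HA _ _ Imge))// ler_wpM2l// ler_expR ler_wpM2l//.
  by rewrite mulr_ge0// mulr_ge0// ltW.
apply: (le_trans (slash_norm_le j Sg tH HM)); rewrite -/w.
have kw : - k * ln w <= `|k| * ln 5 + (`|K| + e) + e / v.
  have lv : ln v <= ln w by rewrite ler_ln ?posrE.
  have l5 : ln w <= ln 5.
    rewrite ler_ln ?posrE// -ler_sqr ?nnegrE ?(ltW w0)//.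
    rewrite (le_trans g5)// expr2 ler_pM2l// (le_trans v1)//; lra.
  have l50 : 0 <= ln 5 :> R by rewrite ln_ge0// ler1n.
  have lv0 : ln v <= 0 by rewrite ln_le0.
  have lw : `|ln w| <= ln 5 - ln v by rewrite ler_norml; apply/andP; split; lra.
  apply: (@le_trans _ _ (`|k| * (ln 5 - ln v))).
    rewrite (le_trans (ler_norm _))// normrM normrN ler_wpM2l//.
  have h := HK v v0; rewrite -/e in h; rewrite [X in X <= _]mulrBr.
  have : `|k| * - ln v <= `|K| + e * (1 + v^-1).
    rewrite mulrN -mulNr (le_trans h)// lerD ?ler_norm//.
    by rewrite ler_wpM2l ?(ltW e0)// lerD2r.
  by rewrite mulrN mulrDr mulr1 => h'; lra.
have -> : expR (2 * pi * c / v) = expR (e / v) * expR (2 * pi * n0%:R / v).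
  by rewrite -expRD; congr expR; rewrite /e; ring.
have := kw; rewrite -ler_expR expRD => h.
apply: (le_trans (ler_wpM2r _ h)).
  by rewrite mulr_ge0// mulr_ge0// expR_ge0.
by rewrite le_eqVlt; apply/orP; left; apply/eqP; ring.
Qed.

End ModularGrowth.

(** * The L-series as a Mellin transform *)

Section DominatedConvergence.
Variable R : realType.
Local Notation mu := (@lebesgue_measure R).
Local Notation E := (`]0%R, +oo[%classic : set (measurableTypeR R)).

Lemma Rintegral_dominated (g_ : nat -> R -> R) (g u : R -> R) :
  (forall n, measurable_fun E (g_ n)) ->
  (forall n t, 0 < t -> `|g_ n t| <= u t) ->
  mu.-integrable E (fun t => (u t)%:E) ->
  (forall t, 0 < t -> g_ n t @[n --> \oo] --> g t) ->
  measurable_fun E g /\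
  \int[mu]_(t in E) g_ n t @[n --> \oo] --> \int[mu]_(t in E) g t.
Proof.
move=> mg gu iu gg.
have mg' : measurable_fun E g.
  apply: (measurable_fun_cvg mg) => t /mem_halfline; exact: gg.
split=> //.
have [||||ig _ c] := @dominated_convergence _ _ R mu E (@measurable_halfline R)
  (fun n t => (g_ n t)%:E) (fun t => (g t)%:E) (fun t => (u t)%:E) _ _ _ iu _.
- by move=> n; exact/measurable_EFinP.
- exact/measurable_EFinP.
- by apply: aeW => t /mem_halfline t0; apply: cvg_EFin;
  [exact: nearW|exact: gg].
- by apply: aeW => t n /mem_halfline t0; rewrite lee_fin gu.
apply: fine_cvg; rewrite fineK//; exact: integrable_fin_num.
Qed.

Lemma cint_dominated (g_ : nat -> R -> R[i]) (g : R -> R[i]) (u : R -> R) :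
  (forall n, cmeasurable (g_ n)) ->
  (forall n t, 0 < t -> normc (g_ n t) <= u t) ->
  mu.-integrable E (fun t => (u t)%:E) ->
  (forall t, 0 < t -> g_ n t @[n --> \oo] --> (g t : R[i]^o)) ->
  cmeasurable g /\ cint (g_ n) @[n --> \oo] --> (cint g : R[i]^o).
Proof.
move=> mg gu iu gg.
have [|||m1 c1] := @Rintegral_dominated (fun n t => Re (g_ n t)) (fun t => Re
  (g t)) u _ _ iu.
- by move=> n; have [] := mg n.
- by move=> n t t0; rewrite (le_trans (normr_Re_le _))// gu.
- by move=> t t0; have /cvg_Re_Im[] := gg t t0.
have [|||m2 c2] := @Rintegral_dominated (fun n t => Im (g_ n t)) (fun t => Im
  (g t)) u _ _ iu.
- by move=> n; have [] := mg n.
- by move=> n t t0; rewrite (le_trans (normr_Im_le _))// gu.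
- by move=> t t0; have /cvg_Re_Im[] := gg t t0.
by split=> //; apply/cvg_Re_Im; split.
Qed.

End DominatedConvergence.

(** * Exchanging the Fourier series with the Laplace integral *)

Section Pairing.
Variables (R : realType) (a : int -> R[i]) (kap : R) (F : R[i] -> R[i]).
Variables (P n0 : nat) (C c1 : R).
Hypothesis a_eq0 : forall n : int, n < - P%:Z -> a n = 0.
Hypothesis hF : forall tau, upper_half tau ->
  has_zsum (fun n : int =>
    a n * cexp (2 * pi%:C * 'i * (n%:~R + kap%:C) * tau)) (F tau).
Hypothesis C0 : 0 <= C.
Hypothesis n0c1 : n0%:R <= c1.
Hypothesis majorant : forall K t, 0 < t ->
  \sum_(i < K) fourier_abs a kap P i t <=
  C * expR (2 * pi * n0%:R * t + 2 * pi * c1 / t).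
Local Notation mu := (@lebesgue_measure R).
Local Notation E := (`]0%R, +oo[%classic : set (measurableTypeR R)).
Local Notation nu := (fourier_freq kap P).
Local Notation tm := (fourier_term a kap P).
Local Notation B := (fourier_abs a kap P).
Variables (psi : R -> R[i]) (c : R).
Hypothesis c1c : c1 < c.
Hypothesis rpsi : rapid (2 * pi * c) psi.

Let pi0 : 0 < pi :> R. Proof. exact: pi_gt0. Qed.
Let tpi0 : 0 < 2 * pi :> R. Proof. by rewrite mulr_gt0. Qed.

Let d := 2 * pi * (c - c1).
Let d0 : 0 < d. Proof. by rewrite mulr_gt0// subr_gt0. Qed.

Let mpsi : cmeasurable psi. Proof. by case: rpsi. Qed.

(** The exponent n0 t + c1 / t - c (t + 1 / t) is at most - (c - c1) (t + 1 / t), because n0 <= c1.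
    The bound is uniform in K and serves for dominated convergence, absolute convergence and the
    decay of F psi alike. *)
Let dominated : exists2 D, 0 <= D & forall K t, 0 < t ->
  (\sum_(i < K) B i t) * normc (psi t) <= D * expR (- (d * (t + t^-1))).
Proof.
have [_ [D HD]] := rpsi; exists (C * `|D|); first by rewrite mulr_ge0.
move=> K t t0.
have h : normc (psi t) <= `|D| * expR (- (2 * pi * c * (t + t^-1))).
  by rewrite (le_trans (HD _ t0))// ler_wpM2r ?expR_ge0// ler_norm.
apply: (@le_trans _ _ (C * expR (2 * pi * n0%:R * t + 2 * pi * c1 / t) *
    (`|D| * expR (- (2 * pi * c * (t + t^-1)))))).
  apply: ler_pM => //; [|exact: normc_ge0|exact: majorant].
  by apply: sumr_ge0 => i _; exact: fourier_abs_ge0.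
rewrite mulrACA ler_wpM2l ?mulr_ge0// -expRD ler_expR /d.
have h2 : 0 <= 2 * pi * ((c1 - n0%:R) * t).
  by rewrite mulr_ge0 ?(ltW tpi0)// mulr_ge0 ?subr_ge0 ?(ltW t0).
rewrite -subr_ge0; apply: le_trans h2 _.
by rewrite le_eqVlt; apply/orP; left; apply/eqP; ring.
Qed.

(** On the imaginary axis the exponential e^(2 pi i nu tau) becomes the Laplace kernel e^(- 2 pi nu
    t). *)
Lemma fourier_term_im i t : tm i (0 +i* t) * psi t =
  a (i%:Z - P%:Z) * laplace_integrand psi (2 * pi * nu i)%:C t.
Proof.
rewrite /fourier_term /laplace_integrand mulrA; congr (_ * cexp _ * _).
by apply: complex_eq; rewrite ?cReM ?cImM ?cReN ?cImN /= ?cReM ?cImM /=; ring.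
Qed.

Lemma cmeasurable_laplace_integrand (s : R[i]) :
  cmeasurable (laplace_integrand psi s).
Proof.
apply: cmeasurableM => //; apply: cmeasurable_cexp; apply: cmeasurableM.
  exact: cmeasurable_cst.
by apply: cmeasurable_real; exact: measurable_id.
Qed.

Let mterm i : cmeasurable (fun t => tm i (0 +i* t) * psi t).
Proof.
under eq_fun do rewrite fourier_term_im.
by apply: cmeasurableM; [exact: cmeasurable_cst|exact:
  cmeasurable_laplace_integrand].
Qed.

Let normc_partial K t : 0 < t ->
  normc (\sum_(i < K) tm i (0 +i* t) * psi t) <= (\sum_(i < K) B i t) * normc
    (psi t).
Proof.
move=> t0; rewrite (le_trans (normc_sum _ _ _))// mulr_suml;
  apply: ler_sum => i _.
by rewrite ComplexField.Normc.normcM normc_fourier_term.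
Qed.

Let dom_le D t : 0 <= D -> 0 < t ->
  D * expR (- (d * (t + t^-1))) <= D * expR (- (d * t)).
Proof.
move=> D0 t0; rewrite ler_wpM2l// ler_expR lerN2 ler_pM2l// lerDl invr_ge0.
exact: ltW.
Qed.

Let iterm i : cintegrable (fun t => tm i (0 +i* t) * psi t).
Proof.
have [D D0 HD] := dominated.
apply: (cintegrable_dom (mterm i) _ (integrable_expR_decay D d0)) => t t0.
apply: (le_trans _ (dom_le D0 t0)); apply: (le_trans _ (HD i.+1 t t0)).
rewrite ComplexField.Normc.normcM normc_fourier_term /=.
rewrite ler_wpM2r ?normc_ge0// big_ord_recr /= lerDr.
by apply: sumr_ge0 => j _; exact: fourier_abs_ge0.
Qed.

Let cint_term i : cint (fun t => tm i (0 +i* t) * psi t) =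
  a (i%:Z - P%:Z) * laplace psi (2 * pi * nu i)%:C.
Proof.
under eq_fun do rewrite fourier_term_im.
rewrite -[laplace _ _]/(cint (laplace_integrand psi (2 * pi * nu i)%:C)).
(* Integrability of the Laplace integrand is recovered from that of the term by dividing by the
   coefficient, so a zero coefficient is treated apart. *)
have [a0|a0] := eqVneq (a (i%:Z - P%:Z)) 0.
  by rewrite a0 mul0r -[RHS](@cint0 R); apply: eq_cint => t _; rewrite mul0r.
rewrite cintZ//.
have := cintegrableZ (a (i%:Z - P%:Z))^-1 (iterm i).
congr cintegrable; apply/funext => t.
by rewrite fourier_term_im mulrA mulVf// mul1r.
Qed.

Let partial_cvg : cmeasurable (fun t => F (0 +i* t) * psi t) /\
  cint (fun t => \sum_(i < K) tm i (0 +i* t) * psi t) @[K --> \oo] -->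
  (cint (fun t => F (0 +i* t) * psi t) : R[i]^o).
Proof.
have [D D0 HD] := dominated.
apply: (@cint_dominated _ (fun K t => \sum_(i < K) tm i (0 +i* t) * psi t)
  _ (fun t => D * expR (- (d * t)))).
- by move=> K; apply: cmeasurable_sum => i; exact: mterm.
- move=> K t t0; rewrite (le_trans (normc_partial K t0))//.
  by rewrite (le_trans (HD K t t0))// dom_le.
- exact: integrable_expR_decay.
- move=> t t0; under eq_fun do rewrite -mulr_suml.
  have tH : upper_half (0 +i* t) by [].
  by apply: cvg_complexMl; exact: (fourier_term_cvg a_eq0 hF tH).
Qed.

Lemma has_zsum_pairing :
  has_zsum (fun n : int => a n * laplace psi (2 * pi * (n%:~R + kap))%:C)
    (cint (fun t => F (0 +i* t) * psi t)).
Proof.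
apply/(has_zsumP (P := P)) => [n nP|]; first by rewrite a_eq0// mul0r.
have [_] := partial_cvg; set S := (X in X @ _ --> _ -> _).
have -> // : S = (fun K => \sum_(i < K) a (i%:Z - P%:Z) *
    laplace psi (2 * pi * ((i%:Z - P%:Z)%:~R + kap))%:C).
apply/funext => K; rewrite /S cint_sum; last by move=> i; exact: iterm.
by apply: eq_bigr => i _; rewrite cint_term.
Qed.

Lemma rapid_fourier : rapid d (fun t => F (0 +i* t) * psi t).
Proof.
have [D D0 HD] := dominated.
split; first by case: partial_cvg.
exists D => t t0; have tH : upper_half (0 +i* t) by [].
have h := fourier_term_cvg a_eq0 hF tH.
have {}h : (\sum_(i < K) tm i (0 +i* t)) * psi t @[K --> \oo] -->
    (F (0 +i* t) * psi t : R[i]^o).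
  exact: cvg_complexMl.
rewrite -[F _ * _]subr0; apply: (cvg_normc_le (N := 0%N) h) => K _.
by rewrite subr0 mulr_suml (le_trans (normc_partial K t0))// HD.
Qed.

Lemma laplace_cvg_rapid (s : R[i]) : - (2 * pi * n0%:R) <= Re s ->
  laplace_cvg psi s.
Proof.
move=> sn0; have [_ [D HD]] := rpsi.
have n0c : n0%:R < c by exact: le_lt_trans c1c.
have e0 : 0 < 2 * pi * (c - n0%:R) by rewrite mulr_gt0// subr_gt0.
apply: (cintegrable_dom (cmeasurable_laplace_integrand s) _
  (integrable_expR_decay `|D| e0)) => t t0.
rewrite /laplace_integrand ComplexField.Normc.normcM normc_cexp.
have h : normc (psi t) <= `|D| * expR (- (2 * pi * c * t)).
  rewrite (le_trans (HD _ t0))// ler_pM ?expR_ge0 ?ler_norm//.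
    by have := le_trans (normc_ge0 _) (HD _ t0); rewrite pmulr_lge0// expR_gt0.
  have c0 : 0 < c by exact: le_lt_trans n0c.
  by rewrite ler_expR lerN2 ler_pM2l ?mulr_gt0// lerDl invr_ge0 ltW.
apply: (le_trans (ler_wpM2l (expR_ge0 _) h)).
rewrite mulrCA ler_wpM2l// -expRD ler_expR cReM cReN cImN /= mulr0 subr0.
have : 0 <= (Re s + 2 * pi * n0%:R) * t.
  by rewrite mulr_ge0 ?(ltW t0)// -lerBlDr sub0r.
move=> h2; rewrite -subr_ge0; apply: le_trans h2 _.
by rewrite le_eqVlt; apply/orP; left; apply/eqP; ring.
Qed.

(** Each finite partial sum is the integral of a finite sum, bounded by the integral of the majorant
    independently of K. The sum over the integers reduces to these, as the terms below - P
    vanish. *)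
Lemma esum_laplace_abs_lty :
  (\esum_(n in [set: int]) ((normc (a n))%:E *
     laplace_abs psi (2 * pi * (n%:~R + kap))%R) < +oo)%E.
Proof.
have [D D0 HD] := dominated.
pose T (n : int) : \bar R :=
  ((normc (a n))%:E * laplace_abs psi (2 * pi * (n%:~R + kap))%R)%E.
have T0 n : (0 <= T n)%E.
  rewrite mule_ge0 ?lee_fin ?normc_ge0//; apply: integral_ge0 => t _.
  by rewrite lee_fin mulr_ge0 ?expR_ge0 ?normc_ge0.
have mabs x : measurable_fun E (fun t => expR (- (x * t)) * normc (psi t)).
  apply: measurable_funM.
    by apply: measurableT_comp => //; apply: measurableT_comp.
  exact: measurable_normc.
have mB i : measurable_fun E (fun t => (B i t * normc (psi t))%:E).
  apply/measurable_EFinP.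
  apply: (measurable_fun_eq _ (measurable_funM
    (measurable_cst (normc (a (i%:Z - P%:Z)))) (mabs (2 * pi * nu i)))) => t _.
  by rewrite /fourier_abs /= mulrA.
pose I := (\int[mu]_(t in E) (D * expR (- (d * t)))%:E)%E.
have Ifin : (I < +oo)%E.
  by have := integrable_lty (@measurable_halfline R) (integrable_expR_decay D
    d0).
have part K : (\sum_(i < K) T (i%:Z - P%:Z)%R <= I)%E.
  have -> : (\sum_(i < K) T (i%:Z - P%:Z)%R =
      \int[mu]_(t in E) (\sum_(i < K) (B i t * normc (psi t))%:E))%E.
    rewrite ge0_integral_sum//=.
    - apply: eq_bigr => i _; rewrite /T /laplace_abs -ge0_integralZl//=.
      + by apply: eq_integral => t _; rewrite -EFinM /fourier_abs mulrA.
      + by apply/measurable_EFinP; exact: mabs.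
      + by move=> t _; rewrite lee_fin mulr_ge0 ?expR_ge0 ?normc_ge0.
      + by rewrite lee_fin normc_ge0.
    - by move=> i t _; rewrite lee_fin mulr_ge0 ?fourier_abs_ge0 ?normc_ge0.
  apply: ge0_le_integral => //=.
  - by move=> t _; apply: sume_ge0 => i _;
    rewrite lee_fin mulr_ge0 ?fourier_abs_ge0 ?normc_ge0.
  - by apply: emeasurable_sum => i; exact: mB.
  - by have /integrableP[] := integrable_expR_decay D d0.
  - move=> t /mem_halfline t0; rewrite sumEFin lee_fin -mulr_suml.
    by rewrite (le_trans (HD K t t0))// dom_le.
rewrite -/T (le_lt_trans _ Ifin)//.
rewrite (esumID [set n : int | - P%:Z <= n]); last by move=> n _; exact: T0.
rewrite !setTI.
rewrite [X in (_ + X)%E]esum1 ?adde0; last first.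
  by move=> n /= /negP; rewrite -ltNge => nP;
    rewrite a_eq0// ComplexField.Normc.normc0 mul0e.
have bij : set_bij [set: nat] [set n : int | - P%:Z <= n] (fun i => i%:Z -
  P%:Z).
  split.
  - by move=> i _ /=; rewrite lerBrDr addNr.
  - by move=> i j _ _ /addIr[].
  - move=> n /= nP; exists (absz (n + P%:Z)) => //=.
    by rewrite gez0_abs ?addrK// -lerBlDr sub0r.
rewrite (@reindex_esum R _ _ _ _ _ T bij) -nneseries_esumT//.
apply: lime_le; first by apply: is_cvg_nneseries => i _ _; exact: T0.
by apply: nearW => K; rewrite big_mkord.
Qed.

End Pairing.

(** * The action of S on the imaginary axis *)

Section InversionMatrix.
Variable R : realType.

Lemma SmxE : Smx = mx22 0 (-1) 1 0.
Proof. by apply/matrixP => -[[|[|//]] ?] [[|[|//]] ?]; rewrite !mxE. Qed.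

Lemma SL2Z_Smx : SL2Z Smx.
Proof. by rewrite /SL2Z /= SmxE det_mx22. Qed.

Lemma autj_Smx (tau : R[i]) : autj Smx tau = tau.
Proof. by rewrite /autj SmxE !mxE /= mul1r addr0. Qed.

Lemma moebius_Smx t : 0 < t -> moebius Smx (0 +i* t : R[i]) = 0 +i* t^-1.
Proof.
move=> t0; rewrite /moebius autj_Smx SmxE !mxE /= mul0r add0r.
have tn0 : (0 +i* t : R[i]) != 0 by rewrite eq_complex /= eqxx /= gt_eqF.
apply: (mulIf tn0); rewrite divfK//; apply: complex_eq; rewrite ?cReM ?cImM /=.
  by rewrite mulVf ?gt_eqF//; ring.
by ring.
Qed.

Lemma cexp_real (x : R) : cexp x%:C = (expR x)%:C.
Proof. by rewrite /cexp /= cos0 sin0 mulr1 mulr0. Qed.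

Lemma cpowN_mul (z w : R[i]) : cpow z (- w) * cpow z w = 1.
Proof. by rewrite /cpow -cexpD -mulrDl addNr mul0r cexp0. Qed.

(** All points i t share the argument of i, so (i t)^k = i^k t^k holds for the principal branch
    without a correction factor. *)
Lemma clog_im t : 0 < t -> clog (0 +i* t : R[i]) = clog 'i + (ln t)%:C.
Proof.
move=> t0; rewrite /clog /carg /= (ltW t0) ler01.
rewrite !expr0n /= !add0r !sqrtr_sqr normr1 ln1 ger0_norm ?ltW//.
by rewrite !mul0r; apply: complex_eq; rewrite ?cReD ?cImD /= ?add0r ?addr0.
Qed.

End InversionMatrix.

Lemma between_thirds (R : realType) (x y : R) : x < y ->
  [/\ x < x + (y - x) / 3, x + (y - x) / 3 < x + (y - x) / 3 * 2
    & x + (y - x) / 3 * 2 < y].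
Proof. by move=> xy; split; lra. Qed.

(** * Convergence, continuation and functional equation of the series *)

Section LSeriesTheory.
Variables (R : realType) (m : nat) (k : R).
Variables (chi : 'M[int]_2 -> R[i]) (rho : 'M[int]_2 -> 'M[R[i]]_m).
Variables (kappa : 'I_m -> R) (f : R[i] -> 'cV[R[i]]_m) (n0 : nat).
Hypothesis hchi : unitary_multiplier k chi.
Hypothesis hrho : unitary_rep rho.
Hypothesis hkappa : forall j, 0 <= kappa j < 1.
Hypothesis hf : weakly_holomorphic_form k chi rho kappa f.
Hypothesis hn0 : growth_at_cusp n0 f.
Implicit Types (phi : R -> R[i]) (s : R[i]).
Local Notation a := (fcoef kappa f).

Lemma fcoef_expansion : fourier_expansion kappa f a.
Proof. by case: hf => _ _ /xgetPex; apply. Qed.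

Lemma fcoef_support : exists P : 'I_m -> nat,
  forall j (n : int), n < - (P j)%:Z -> a j n = 0.
Proof.
have /choice[P HP] : forall j, exists P : nat,
    forall n : int, n < - P%:Z -> a j n = 0.
  move=> j; have [[n1 H] _] := fcoef_expansion j.
  exists `|n1|%N => n nn1; apply: H; apply: lt_le_trans nn1 _.
  by rewrite lerNl abszE -normrN ler_norm.
by exists P.
Qed.

Let pi0 : 0 < pi :> R. Proof. exact: pi_gt0. Qed.

Lemma fourier_majorant (P : 'I_m -> nat) (c1 : R) : n0%:R < c1 ->
  (forall j (n : int), n < - (P j)%:Z -> a j n = 0) ->
  forall j, exists2 C, 0 <= C & forall K t, 0 < t ->
    \sum_(i < K) fourier_abs (a j) (kappa j) (P j) i t <=
    C * expR (2 * pi * n0%:R * t + 2 * pi * c1 / t).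
Proof.
move=> n0c1 HP.
have hF j : forall tau, upper_half tau -> has_zsum (fun n : int =>
    a j n * cexp (2 * pi%:C * 'i * (n%:~R + (kappa j)%:C) * tau)) (f tau j 0).
  by have [] := fcoef_expansion j.
have n00 : 0 <= n0%:R :> R by [].
(* The threshold 1 / 5 is the height that [modular_reduction] guarantees. *)
have /choice[A HA] : forall j, exists A, 0 <= A /\ forall tau, 5^-1 <= Im tau ->
    normc (f tau j 0) <= A * expR (2 * pi * n0%:R * Im tau).
  move=> j; have [//|A A0 HA] :=
    fourier_norm_le_high (hkappa j) (@HP j) (hF j) (hn0 j) (v0 := 5^-1).
  by exists A.
have [g g0 gE] : exists2 C, 0 <= C & forall j u v, 0 < v <= 1 ->
    normc (f (u +i* v) j 0) <= C * expR (2 * pi * ((n0%:R + c1) / 2) / v).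
  (* One constant must serve all components, since rho mixes them; hence the sum of the A j. The
     midpoint of n0 and c1 leaves strict room here and for [fourier_sum_le_low]. *)
  have [] := @modular_growth R m k chi rho f _ _ _ n0 (\sum_j A j) ((n0%:R +
    c1) / 2).
  - by case: hchi.
  - by case: hrho.
  - by case: hf.
  - by rewrite ltr_pdivlMr//; lra.
  - by apply: sumr_ge0 => j _; have [] := HA j.
  - move=> j tau t5; have [_ h] := HA j; apply: (le_trans (h _ t5)).
    rewrite ler_wpM2r ?expR_ge0// (bigD1 j)//= lerDl.
    by apply: sumr_ge0 => i _; have [] := HA i.
  move=> C HC; exists `|C| => // j u v v01; apply: (le_trans (HC _ _ _ v01)).
  by rewrite ler_wpM2r ?expR_ge0// ler_norm.
move=> j.
have [||C1 H1] := fourier_sum_le_low (hkappa j) (@HP j) (hF j) _ _ (gE j) (c1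
  := c1).
- by rewrite divr_gt0//; lra.
- by rewrite ltr_pdivrMr//; lra.
have [//|A1 A10 H2] := fourier_sum_le_high (hkappa j) (@HP j) (hF j) (hn0 j)
  (v0 := 1).
have c10 : 0 <= c1 by lra.
exists (`|C1| + A1) => [|K t t0]; first by rewrite addr_ge0.
have e1 : 0 <= 2 * pi * n0%:R * t by rewrite mulr_ge0 ?(ltW t0)//
  mulr_ge0// mulr_ge0 ?ltW.
have e2 : 0 <= 2 * pi * c1 / t by rewrite divr_ge0 ?(ltW t0)//
  mulr_ge0// mulr_ge0 ?ltW.
have [t1|t1] := leP t 1.
  have t01 : 0 < t <= 1 by rewrite t0.
  apply: (le_trans (H1 t K t01)); apply: ler_pM; rewrite ?expR_ge0//;
    last 2 first.
  - by rewrite (le_trans (ler_norm _))// lerDl.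
  - by rewrite ler_expR lerDr.
  have h : 0 <= \sum_(i < K) fourier_abs (a j) (kappa j) (P j) i t.
    by apply: sumr_ge0 => i _; exact: fourier_abs_ge0.
  by have := le_trans h (H1 t K t01); rewrite pmulr_lge0// expR_gt0.
apply: (le_trans (H2 t K (ltW t1))); apply: ler_pM; rewrite ?expR_ge0//.
  by rewrite lerDr.
by rewrite ler_expR lerDl.
Qed.

Section RapidTestFunction.
Variables (phi : R -> R[i]) (c : R).
Hypothesis n0c : n0%:R < c.
Hypothesis rphi : rapid (2 * pi * c) phi.

(** [c1] bounds the Fourier majorant near 0 and [c2] is the decay left after multiplying phi by
    t^(s-1); the gap between them gives integrability. *)
Let c1 : R := n0%:R + (c - n0%:R) / 3.
Let c2 : R := n0%:R + (c - n0%:R) / 3 * 2.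

Let cs : [/\ n0%:R < c1, c1 < c2 & c2 < c].
Proof. exact: between_thirds n0c. Qed.

Let rtwist s : rapid (2 * pi * c2) (twist phi s).
Proof.
have [_ _ h] := cs; apply: rapid_cpow rphi.
by rewrite ltr_pM2l// mulr_gt0.
Qed.

Let fourier_at j : forall tau, upper_half tau -> has_zsum (fun n : int =>
  a j n * cexp (2 * pi%:C * 'i * (n%:~R + (kappa j)%:C) * tau)) (f tau j 0).
Proof. by have [] := fcoef_expansion j. Qed.

Lemma Lseries_abs_cvg_rapid s : Lseries_abs_cvg kappa n0 s f phi.
Proof.
have [h1 h2 h3] := cs; have [P HP] := fcoef_support.
split=> [s' s'n0|j].
  exact: (laplace_cvg_rapid (ltW h1) h2 (rtwist s)).
have [C C0 HC] := fourier_majorant h1 HP j.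
exact: (esum_laplace_abs_lty (@HP j) C0 (ltW h1) HC h2 (rtwist s)).
Qed.

Lemma LseriesE s j : Lseries kappa s f phi j 0 =
  cint (fun t => f (0 +i* t) j 0 * phi t * cpow t%:C (s - 1)).
Proof.
have [h1 h2 h3] := cs; have [P HP] := fcoef_support.
have [C C0 HC] := fourier_majorant h1 HP j.
rewrite /Lseries /Lpairing mxE /zsum.
have h := has_zsum_pairing (@HP j) (@fourier_at j) C0 (ltW h1) HC h2 (rtwist s).
rewrite /has_zsum in h; rewrite (cvg_lim (@norm_hausdorff _ R[i]^o) h).
by apply: eq_cint => t _; rewrite /twist mulrA.
Qed.

Lemma Lseries_entire j :
  holomorphic_on setT (fun s => Lseries kappa s f phi j 0).
Proof.
have [h1 h2 h3] := cs; have [P HP] := fcoef_support.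
have [C C0 HC] := fourier_majorant h1 HP j.
have c1c : c1 < c by exact: lt_trans h3.
have r := rapid_fourier (@HP j) (@fourier_at j) C0 (ltW h1) HC c1c rphi.
under eq_fun do rewrite LseriesE.
apply: (mellin_entire _ r).
by rewrite mulr_gt0 ?subr_gt0// mulr_gt0.
Qed.

Lemma Lseries_cintegrable s j :
  cintegrable (fun t => f (0 +i* t) j 0 * phi t * cpow t%:C (s - 1)).
Proof.
have [h1 h2 h3] := cs; have [P HP] := fcoef_support.
have [C C0 HC] := fourier_majorant h1 HP j.
have c1c : c1 < c by exact: lt_trans h3.
have r := rapid_fourier (@HP j) (@fourier_at j) C0 (ltW h1) HC c1c rphi.
have d0 : 0 < 2 * pi * (c - c1) by rewrite mulr_gt0 ?subr_gt0// mulr_gt0.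
have d20 : 0 < 2 * pi * (c - c1) / 2 by rewrite divr_gt0.
apply: (rapid_integrable d20); apply: (rapid_cpow _ _ r).
by rewrite ltr_pdivrMr// ltr_pMr// ltr1n.
Qed.

Lemma Lseries_cmeasurable s j :
  cmeasurable (fun t => f (0 +i* t) j 0 * phi t * cpow t%:C (s - 1)).
Proof.
have [h1 h2 h3] := cs; have [P HP] := fcoef_support.
have [C C0 HC] := fourier_majorant h1 HP j.
have c1c : c1 < c by exact: lt_trans h3.
have [mF _] := rapid_fourier (@HP j) (@fourier_at j) C0 (ltW h1) HC c1c rphi.
by apply: cmeasurableM => //; exact: cmeasurable_cpow.
Qed.

End RapidTestFunction.

(** Inversion preserves the symmetric decay, and the factor x^(k-1) costs only the gap between c and
    c'. *)
Lemma rapid_slashS phi (c c' : R) : c' < c -> rapid c phi ->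
  rapid c' (slashS k chi phi).
Proof.
move=> cc rphi.
apply: (@rapid_eq _ _ (fun t => chi Smx * (phi t^-1 * cpow t%:C (k - 1)%:C))).
  move=> t t0; rewrite /slashS cpow_pos// -rmorphM cexp_real /powR gt_eqF//.
  by ring.
by apply: rapidZ; apply: (rapid_cpow _ cc); exact: rapid_inv.
Qed.

(** Invariance under S at i t, solved for the value at i / t: rho(S) is invertible because it is
    unitary, and chi(S) is nonzero because its modulus is 1. *)
Lemma form_inversion t : 0 < t -> f (0 +i* t^-1) =
  (cpow (0 +i* t) k%:C * chi Smx) *: (rho Smx *m f (0 +i* t)).
Proof.
move=> t0; have tH : upper_half (0 +i* t) by [].
case: hf => _ /(_ Smx _ SL2Z_Smx tH) <- _;
  rewrite /slash autj_Smx moebius_Smx//.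
have chi0 : chi Smx != 0.
  apply/eqP => h; have [/(_ _ SL2Z_Smx)] := hchi.
  by rewrite h ComplexField.Normc.normc0 => /esym/eqP; rewrite oner_eq0.
have uS : rho Smx \in unitmx.
  by apply: unitarymx_unit; case: hrho => /(_ _ SL2Z_Smx).
rewrite -scalemxAr scalerA mulmxA mulmxV// mul1mx.
rewrite mulrACA [_ * cpow _ _]mulrC rmorphN cpowN_mul mul1r mulfV// scale1r//.
Qed.

Lemma functional_equation phi (c : R) s : n0%:R < c -> rapid (2 * pi * c) phi ->
  Lseries kappa s f phi = cpow 'i k%:C *:
    (rho Smx *m Lseries kappa (1 - s) f (slashS k chi phi)).
Proof.
move=> n0c rphi; pose c' := (n0%:R + c) / 2.
have n0c' : n0%:R < c' by rewrite /c'; lra.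
have rS : rapid (2 * pi * c') (slashS k chi phi).
  by apply: rapid_slashS rphi; rewrite ltr_pM2l ?mulr_gt0// /c'; lra.
have sc (z : R[i]) (A : 'cV[R[i]]_m) j : (z *: A) j 0 = z * A j 0.
  by rewrite mxE.
have mm (A : 'M[R[i]]_m) (B : 'cV[R[i]]_m) j :
    (A *m B) j 0 = \sum_l A j l * B l 0 by rewrite mxE.
apply/matrixP => j z; rewrite ord1 {z} (LseriesE n0c rphi) sc mm.
rewrite cint_inversion; last exact: (Lseries_cmeasurable n0c rphi).
rewrite mulr_sumr.
under [RHS]eq_bigr => l _ do rewrite (LseriesE n0c' rS) mulrA
  -(cintZ _ (Lseries_cintegrable n0c' rS _ _)).
rewrite -cint_sum; last first.
  by move=> l; apply: cintegrableZ; exact: (Lseries_cintegrable n0c' rS).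
apply: eq_cint => t t0; rewrite (form_inversion t0) sc mm mulr_sumr !mulr_suml.
apply: eq_bigr => l _.
(* Both sides equal i^k t^(k-1-s): on the left (i t)^k comes from modularity, t^(1-s) from the
   Mellin kernel at 1 / t, and t^-2 from the substitution. *)
have e : cpow (0 +i* t) k%:C * (cpow (t^-1)%:C (s - 1) * (t^-1 ^+ 2)%:C) =
    cpow 'i k%:C * ((t `^ (k - 1))%:C * cpow t%:C (1 - s - 1)).
  have tV : 0 < t^-1 by rewrite invr_gt0.
  have -> : t^-1 ^+ 2 = expR (- (2 * ln t)).
    by rewrite expRN mulrC expRM_natr lnK ?posrE// exprVn.
  rewrite /powR gt_eqF// -!cexp_real !cpow_pos// lnV ?posrE// /cpow clog_im//.
  rewrite -!cexpD; congr cexp; rewrite !rmorphN !rmorphM rmorphB rmorph_nat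
    rmorph1.
  ring.
rewrite /slashS.
transitivity (cpow (0 +i* t) k%:C * (cpow (t^-1)%:C (s - 1) * (t^-1 ^+ 2)%:C) *
  (chi Smx * rho Smx j l * f (0 +i* t) l 0 * phi t^-1)); first by ring.
by rewrite e; ring.
Qed.

End LSeriesTheory.

(** * Piecewise smooth test functions *)

Section PiecewiseSmooth.
Variable R : realType.
Implicit Types (h : R -> R) (a b c t : R).

(** A segment is a finite union of the open pieces and the break points. Treating the latter as
    singletons allows arbitrary values there. *)
Lemma itv_partition_ind (Q : set R -> Prop) a b (s : seq R) :
  itv_partition a b s ->
  (forall A B, Q A -> Q B -> Q (A `|` B)) -> (forall x, Q [set x]) ->
  (forall i, (i < size s)%N -> Q `]nth a (a :: s) i, nth a s i[%classic) ->
  Q `[a, b]%classic.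
Proof.
move=> + QU Q1; elim: s a => [|x s ih] a.
  by move=> [_ /eqP /= <-] _; rewrite set_itv1.
move=> [/= /andP[ax xs] lb] H.
have xb : x <= b by apply: (itv_partition_le (s := s)); split.
have -> : `[a, b]%classic = [set a] `|` `]a, x[%classic `|` `[x, b]%classic.
  apply/seteqP; split => y /=; rewrite !in_itv /=.
    move=> /andP[]; rewrite le_eqVlt => /predU1P[->|ay] yb; first by left; left.
    by have [_|_] := leP x y; [right; rewrite yb|left; right; rewrite ay].
  move=> [[->|/andP[ay yx]]|/andP[xy ->]].
  - by rewrite lexx (le_trans (ltW ax)).
  - by rewrite (ltW ay) (le_trans (ltW yx)).
  - by rewrite (le_trans (ltW ax)).
apply: (QU); first by apply: (QU) => //; exact: (H 0%N).
apply: ih; first by split.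
move=> i si; have := H i.+1; rewrite /= ltnS => /(_ si).
have -> : nth a (x :: s) i = nth x (x :: s) i.
  by apply: set_nth_default; rewrite /= ltnW.
by rewrite (set_nth_default x a).
Qed.

Lemma smooth_piece_continuous h a b : smooth_on_piece h a b ->
  {in `]a, b[%classic, continuous h}.
Proof.
move=> /(_ 0%N)[dh _ _] x; rewrite inE /= in_itv /= => /dh /=.
by move=> /derivable1_diffP/differentiable_continuous.
Qed.

(** The one-sided limits bound h near both ends; in between, h is continuous on a compact segment,
    empty when the two end regions overlap. *)
Lemma smooth_piece_bounded h a b : smooth_on_piece h a b ->
  exists M, forall x, a < x < b -> `|h x| <= M.
Proof.
move=> sh; have ch := smooth_piece_continuous sh.
have [_ /cvg_ex[/= la hla] /cvg_ex[/= lb hlb]] := sh 0%N.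
move/cvgrPdist_lt : hla => /(_ 1 ltr01);
  move/cvgrPdist_lt : hlb => /(_ 1 ltr01).
move=> [e2 /= e20 H2] [e1 /= e10 H1].
pose a' := a + e1 / 2; pose b' := b - e2 / 2.
have [M HM] : exists M, forall x, a < x < b -> a' <= x <= b' -> `|h x| <= M.
  have [ab'|ab'] := leP a' b'; last first.
    exists 0 => x _ /andP[ax xb].
    by have := le_trans ax xb; rewrite leNgt ab'.
  have aa' : a < a' by rewrite ltrDl divr_gt0.
  have bb' : b' < b by rewrite ltrBlDr ltrDl divr_gt0.
  have [|x0 _ Hx0] := @EVT_max R (fun x => `|h x|) a' b' ab'.
    apply: continuous_in_subspaceT => x;
      rewrite inE /= in_itv /= => /andP[ax xb].
    apply: continuous_comp; last exact: norm_continuous.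
    by apply: ch; rewrite inE /= in_itv /= (lt_le_trans aa')// (le_lt_trans xb).
  by exists `|h x0| => x _ xab; apply: Hx0; rewrite in_itv.
exists (Num.max M (Num.max (`|la| + 1) (`|lb| + 1))) => x /andP[ax xb].
rewrite !le_max.
have near_le l : `|l - h x| < 1 -> `|h x| <= `|l| + 1.
  move=> hl; have -> : h x = l - (l - h x) by ring.
  by rewrite (le_trans (ler_normB _ _))// lerD2l ltW.
have [xa'|a'x] := ltP x a'.
  apply/orP; right; apply/orP; left; apply: near_le; apply: H1 => //=.
  rewrite distrC ger0_norm ?subr_ge0 ?(ltW ax)// ltrBlDl (lt_trans xa')//.
  by rewrite ltrD2l ltr_pdivrMr// ltr_pMr// ltr1n.
have [b'x|xb'] := ltP b' x.
  apply/orP; right; apply/orP; right; apply: near_le; apply: H2 => //=.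
  rewrite ger0_norm ?subr_ge0 ?(ltW xb)// ltrBlDl -ltrBlDr (lt_trans _ b'x)//.
  by rewrite ltrD2l ltrN2 ltr_pdivrMr// ltr_pMr// ltr1n.
by rewrite HM ?ax ?a'x.
Qed.

Lemma piecewise_segment (phi : R -> R[i]) a b : piecewise_smooth phi ->
  0 < a -> a < b ->
  [/\ measurable_fun `[a, b] (fun x => Re (phi x)),
      measurable_fun `[a, b] (fun x => Im (phi x)) &
      exists M, forall x, a <= x <= b -> normc (phi x) <= M].
Proof.
move=> hphi a0 ab; have [s abs H] := hphi a b a0 ab.
have meas (h : R -> R) : (forall i, (i < size s)%N ->
    smooth_on_piece h (nth a (a :: s) i) (nth a s i)) ->
    measurable_fun `[a, b] h /\ exists M, forall x, a <= x <= b -> `|h x| <= M.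
  move=> Hh; split.
    suff [] : measurable (`[a, b]%classic : set R) /\
      measurable_fun `[a, b] h by [].
    apply: (@itv_partition_ind (fun A => measurable A /\ measurable_fun A h) a
      b s) => //.
    - move=> A B [mA hA] [mB hB]; split; first exact: measurableU.
      exact/measurable_funU.
    - by move=> x; split; [exact: measurable_set1|exact: measurable_fun_set1].
    - move=> i si; split; first exact: measurable_itv.
      apply: open_continuous_measurable_fun; first exact: interval_open.
      exact: smooth_piece_continuous (Hh i si).
  have [M HM] : exists M, forall x, `[a, b]%classic x -> `|h x| <= M.
    apply: (@itv_partition_ind (fun A => exists M, forall x,
      A x -> `|h x| <= M) a b s) => //.
    - move=> A B [M1 H1] [M2 H2]; exists (Num.max M1 M2) => x [/H1|/H2] hx;
        by rewrite le_max hx ?orbT.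
    - by move=> x; exists `|h x| => y ->.
    - move=> i si; have [M HM] := smooth_piece_bounded (Hh i si).
      by exists M => x; rewrite /= in_itv /= => /HM.
  by exists M => x xab; apply: HM; rewrite /= in_itv.
have [mR [MR HR]] := meas (fun x => Re (phi x)) (fun i si => (H i si).1).
have [mI [MI HI]] := meas (fun x => Im (phi x)) (fun i si => (H i si).2).
split=> //; exists (MR + MI) => x xab.
by rewrite (le_trans (normc_le_ReIm _))// lerD ?HR ?HI.
Qed.

(** The half-line is exhausted by the segments [1 / (n + 2), n + 2]; starting at 2 keeps their end
    points distinct. *)
Lemma piecewise_cmeasurable (phi : R -> R[i]) :
  piecewise_smooth phi -> cmeasurable phi.
Proof.
move=> hphi.
have E : `]0%R, +oo[%classic =
    \bigcup_n `[n.+2%:R^-1, n.+2%:R]%classic :> set R.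
  apply/seteqP; split => x /=.
    rewrite in_itv /= andbT => x0.
    exists (Num.truncn (Num.max x x^-1)) => //=; rewrite in_itv /=.
    have /ltW := truncnS_gt (Num.max x x^-1).
    set n := Num.truncn _; rewrite ge_max => /andP[h1 h2].
    have nn : n.+1%:R <= n.+2%:R :> R by rewrite ler_nat.
    rewrite (le_trans h1 nn) andbT invf_ple ?posrE//; exact: le_trans nn.
  by move=> [n _] /=; rewrite !in_itv /= andbT => /andP[+ _];
    apply: lt_le_trans.
have ab (n : nat) : n.+2%:R^-1 < n.+2%:R :> R.
  by rewrite (@lt_trans _ _ 1) ?ltr1n// invf_lt1// ltr1n.
rewrite /cmeasurable E; split; apply/measurable_fun_bigcup => n;
  (try exact: measurable_itv);
  by have [] := piecewise_segment hphi (_ : 0 < n.+2%:R^-1) (ab n);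
    rewrite ?invr_gt0.
Qed.

Lemma little_o_exp_le (phi : R -> R[i]) c : little_o_exp phi c ->
  exists2 T, 1 < T & forall x, T <= x -> normc (phi x) <= expR (- (2 * pi * c *
    x)).
Proof.
move=> /cvgrPdist_lt/(_ 1 ltr01)[M [_ HM]].
exists (Num.max 2 (M + 1)) => [|x]; first by rewrite lt_max ltr1n.
rewrite ge_max => /andP[_ Mx].
have /HM : M < x by rewrite (lt_le_trans _ Mx)// ltrDl.
rewrite /= sub0r normrN ger0_norm ?divr_ge0 ?normc_ge0 ?expR_ge0//.
by rewrite ltr_pdivrMr ?expR_gt0// mul1r => /ltW.
Qed.

Lemma piecewise_rapid (phi : R -> R[i]) c : 0 < c -> piecewise_smooth phi ->
  little_o_exp phi c -> little_o_exp (fun x => phi x^-1) c ->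
  rapid (2 * pi * c) phi.
Proof.
move=> c0 hphi /little_o_exp_le[T1 T11 H1] /little_o_exp_le[T2 T21 H2].
split; first exact: piecewise_cmeasurable.
have T10 : 0 < T1 by exact: lt_trans T11.
have T20 : 0 < T2 by exact: lt_trans T21.
have T2V : 0 < T2^-1 by rewrite invr_gt0.
have T2V1 : T2^-1 < 1 by rewrite invf_lt1.
have [_ _ [M HM]] := piecewise_segment hphi T2V (lt_trans T2V1 T11).
have p0 : 0 < 2 * pi * c by rewrite mulr_gt0// mulr_gt0// pi_gt0.
pose Q := `|M| + 1.
exists (Q * expR (2 * pi * c * (T1 + T2))) => t t0.
have Q1 : 1 <= Q by rewrite lerDr.
have step x : normc (phi t) <= Q * expR x ->
    x <= 2 * pi * c * (T1 + T2 - (t + t^-1)) ->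
    normc (phi t) <= Q * expR (2 * pi * c * (T1 + T2)) * expR (- (2 * pi * c *
      (t + t^-1))).
  move=> h1 h2; apply: (le_trans h1); rewrite -[X in _ <= X]mulrA -expRD.
  rewrite ler_wpM2l ?(le_trans ler01 Q1)// ler_expR (le_trans h2)//.
  by rewrite mulrBr.
have tV0 : 0 < t^-1 by rewrite invr_gt0.
have [T1t|tT1] := leP T1 t.
  apply: (step (- (2 * pi * c * t))).
    by rewrite (le_trans (H1 t T1t))// ler_peMl ?expR_ge0.
  rewrite -mulrN ler_pM2l//.
  have : t^-1 <= 1 by rewrite invf_le1// (le_trans (ltW T11)).
  lra.
have [T2t|tT2] := leP T2 t^-1.
  apply: (step (- (2 * pi * c * t^-1))).
    have := H2 t^-1 T2t; rewrite invrK => /le_trans; apply.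
    by rewrite ler_peMl ?expR_ge0.
  rewrite -mulrN ler_pM2l//.
  have : t <= 1.
    by rewrite -[t]invrK invf_le1// (le_trans (ltW T21)).
  lra.
apply: (step 0).
  rewrite expR0 mulr1 (le_trans (HM _ _))//;
    last by rewrite (le_trans (ler_norm _))// lerDl.
  by rewrite (ltW tT1) andbT invf_ple ?posrE// ltW.
rewrite mulr_ge0 ?(ltW p0)// ; lra.
Qed.

End PiecewiseSmooth.

Unset Implicit Arguments.
Set Strict Implicit.

Theorem theorem2p2 (R : realType) (m : nat) (k : R)
    (chi : 'M[int]_2 -> R[i]) (rho : 'M[int]_2 -> 'M[R[i]]_m)
    (kappa : 'I_m -> R) (f : R[i] -> 'cV[R[i]]_m) (n0 : nat)
    (phi : R -> R[i])
    (hk : half_integer k)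
    (hchi : unitary_multiplier k chi)
    (hrho : unitary_rep rho)
    (hkappa : forall j, 0 <= kappa j < 1)
    (hf : weakly_holomorphic_form k chi rho kappa f)
    (hn0 : growth_at_cusp n0 f)
    (hphi_neq0 : exists x : R, 0 < x /\ phi x <> 0)
    (hphi_smooth : piecewise_smooth phi)
    (hphi_decay : exists eps : R,
       [/\ 0 < eps,
           little_o_exp phi (n0%:R + eps)
         & little_o_exp (fun x => phi x^-1) (n0%:R + eps)]) :
  (forall s : R[i], 1 / 2 < complex.Re s -> Lseries_abs_cvg kappa n0 s f phi) /\
  exists F : R[i] -> 'cV[R[i]]_m,
    is_entire_continuation (fun s => Lseries kappa s f phi) F /\
    exists G : R[i] -> 'cV[R[i]]_m,
      [/\ forall s : R[i], 1 / 2 < complex.Re s ->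
            Lseries_abs_cvg kappa n0 s f (slashS k chi phi),
          is_entire_continuation
            (fun s => Lseries kappa s f (slashS k chi phi)) G
        & forall s : R[i],
            F s = cpow 'i k%:C *: (rho Smx *m G (1 - s))].
Proof.
have [eps [eps0 h1 h2]] := hphi_decay.
have n00 : 0 <= n0%:R :> R by [].
have c0 : 0 < n0%:R + eps by rewrite ltr_wpDl.
have rphi := piecewise_rapid c0 hphi_smooth h1 h2.
have n0c : n0%:R < n0%:R + eps by rewrite ltrDl.
(* The other half of [eps] pays for the factor x^(k-1) in [slashS]. *)
pose c' := n0%:R + eps / 2.
have n0c' : n0%:R < c' by rewrite ltrDl divr_gt0.
have c'c : c' < n0%:R + eps by rewrite ltrD2l ltr_pdivrMr// ltr_pMr// ltr1n.
have rS : rapid (2 * pi * c') (slashS k chi phi).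
  by apply: rapid_slashS rphi; rewrite ltr_pM2l// mulr_gt0// pi_gt0.
split=> [s _|]; first exact: (Lseries_abs_cvg_rapid hchi hrho hkappa hf hn0 n0c
  rphi).
exists (fun s => Lseries kappa s f phi); split.
  by split=> // j; exact: (Lseries_entire hchi hrho hkappa hf hn0 n0c rphi).
exists (fun s => Lseries kappa s f (slashS k chi phi)); split.
- by move=> s _; exact: (Lseries_abs_cvg_rapid hchi hrho hkappa hf hn0 n0c' rS).
- by split=> // j; exact: (Lseries_entire hchi hrho hkappa hf hn0 n0c' rS).
- by move=> s; exact: (functional_equation hchi hrho hkappa hf hn0 s n0c rphi).
Qed.
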